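(* Let Assumptions 1 and 2 (stated in the context) hold, and let $\lambda>0$ satisfy $\lambda \geq 2\|\nabla\mathscr{L}_{\mathcal{Y}}(\mathcal{M})\|$. Let $\widehat{\mathcal{M}}$ be the nuclear-norm penalized estimator defined in the context. Then there is a numerical constant $c>0$ such that, with probability at least $1-4/(d_u+D)$, $$\frac{1}{d_uD}\|\widehat{\mathcal{M}}-\mathcal{M}\|_{\Pi,F}^2 \leq \frac{c}{p}\max\Big\{d_uD\,\mathrm{rk}(\mathcal{M})\Big(\frac{\lambda^2}{L_\gamma^4}+\gamma^2\big(\mathbb{E}[\|\Sigma_R\|]\big)^2\Big),\ \frac{\gamma^2\log(d_u+D)}{d_uD}\Big\}.$$
   Context: Let $V,d_u,d_1,\dots,d_V\ge 1$ be integers and $D=\sum_{v=1}^V d_v$. A collective matrix $\mathcal{A}=(A^1,\dots,A^V)\in\mathbb{R}^{d_u\times D}$ is the horizontal concatenation of blocks $A^v\in\mathbb{R}^{d_u\times d_v}$ with entries $A^v_{ij}$. $E^v_{ij}$ denotes the $d_u\times D$ matrix with entry $1$ at position $(i,j)$ of block $v$ and $0$ elsewhere. $\|\cdot\|_F$ is the Frobenius norm, $\|\cdot\|_*$ the nuclear norm (sum of singular values), $\|\cdot\|$ the operator norm, $\|\cdot\|_\infty$ the maximum absolute entry, $\mathrm{rk}$ the rank. Sampling: for $v\in[V]$, $(i,j)\in[d_u]\times[d_v]$, the $B^v_{ij}$ are independent Bernoulli random variables with parameters $\pi^v_{ij}$. Assumption 1: there is $0<p<1$ with $\pi^v_{ij}\ge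 p$ for all $v,i,j$. Weighted Frobenius norm: $\|\mathcal{A}\|_{\Pi,F}^2=\sum_{v}\sum_{(i,j)\in[d_u]\times[d_v]}\pi^v_{ij}(A^v_{ij})^2$. $\mu$ denotes a number with $\sum_{v\in[V]}\sum_{j\in[d_v]}\pi^v_{ij}\le\mu$ for every $i\in[d_u]$ and $\sum_{i\in[d_u]}\pi^v_{ij}\le\mu$ for every $v\in[V]$, $j\in[d_v]$. $\mathscr{C}_\infty(\gamma)=\{\mathcal{W}\in\mathbb{R}^{d_u\times D}:\|\mathcal{W}\|_\infty\le\gamma\}$. Let $(\varepsilon^v_{ij})$ be i.i.d. Rademacher variables independent of everything else, and $\Sigma_R=\frac{1}{d_uD}\sum_{v}\sum_{(i,j)}\varepsilon^v_{ij}B^v_{ij}E^v_{ij}$. Exponential family setting: the random variables $X^v_{ij}$ are independent over $(v,i,j)$ and independent of the $B$'s; $X^v_{ij}$ has density $h^v(x)\exp\big(xM^v_{ij}-G^v(M^v_{ij})\big)$ (with respect to a reference measure), where $h^v\ge0$ and $G^v$ is the log-partition function. $\mathcal{M}=(M^1,\dots,M^V)$ and $\gamma>0$ satisfies $\|\mathcal{M}\|_\infty\le\gamma$. One observes $Y^v_{ij}=B^v_{ij}X^v_{ij}$, $\mathcal{Y}=(Y^1,\dots,Y^V)$. Assumption 2: each $G^v$ is twice differentiable and there are constants $K>0$, $L_\gamma,U_\gamma>0$ with $L_\gamma^2\le (G^v)''(\eta)\le U_\gamma^2$ for all $v$ and all $\eta\in[-\gamma-1/K,\gamma+1/K]$.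 Negative log-likelihood: $\mathscr{L}_{\mathcal{Y}}(\mathcal{W})=-\frac{1}{d_uD}\sum_v\sum_{(i,j)}B^v_{ij}\big(Y^v_{ij}W^v_{ij}-G^v(W^v_{ij})\big)$, with gradient $\nabla\mathscr{L}_{\mathcal{Y}}(\mathcal{W})=-\frac{1}{d_uD}\sum_v\sum_{(i,j)}B^v_{ij}\big(Y^v_{ij}-(G^v)'(W^v_{ij})\big)E^v_{ij}$. Estimator: $\widehat{\mathcal{M}}\in\arg\min_{\mathcal{W}\in\mathscr{C}_\infty(\gamma)}\mathscr{L}_{\mathcal{Y}}(\mathcal{W})+\lambda\|\mathcal{W}\|_*$. *)

(* Defs.v *)
From Stdlib Require Import Reals Lra List ClassicalEpsilon ClassicalDescription.
Import ListNotations.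
Open Scope R_scope.

(* A collective matrix (A^1,...,A^V) is represented by its entries
   A v i j = A^{v+1}_{i+1,j+1} for v < V, i < d_u, j < d_v (0-based indices).
   Entries outside this range are irrelevant. *)
Definition cmat := nat -> nat -> nat -> R.

Fixpoint rsum (n : nat) (f : nat -> R) : R :=
  match n with O => 0 | S m => rsum m f + f m end.

Definition Dtot (V : nat) (d : nat -> nat) : nat :=
  fold_right Nat.add 0%nat (map d (seq 0 V)).

Definition csum3 (V du : nat) (d : nat -> nat) (f : nat -> nat -> nat -> R) : R :=
  rsum V (fun v => rsum du (fun i => rsum (d v) (fun j => f v i j))).

Definition csum2 (V : nat) (d : nat -> nat) (f : nat -> nat -> R) : R :=
  rsum V (fun v => rsum (d v) (fun j => f v j)).

Definition in_range (V du : nat) (d : nat -> nat) (v i j : nat) : Prop :=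
  (v < V)%nat /\ (i < du)%nat /\ (j < d v)%nat.

Definition opnorm_set (V du : nat) (d : nat -> nat) (A : cmat) : R -> Prop :=
  fun t => exists x : nat -> nat -> R,
    csum2 V d (fun v j => x v j ^ 2) = 1 /\
    t = sqrt (rsum du (fun i => (csum2 V d (fun v j => A v i j * x v j)) ^ 2)).

Definition opnorm (V du : nat) (d : nat -> nat) (A : cmat) : R :=
  epsilon (inhabits 0) (fun r => is_lub (opnorm_set V du d A) r).

Definition is_svd (V du : nat) (d : nat -> nat) (A : cmat) (k : nat)
  (sigma : nat -> R) (u : nat -> nat -> R) (w : nat -> nat -> nat -> R) : Prop :=
  (forall l, (l < k)%nat -> 0 < sigma l) /\
  (forall l l', (l < k)%nat -> (l' < k)%nat ->
     rsum du (fun i => u l i * u l' i) = (if Nat.eqb l l' then 1 else 0)) /\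
  (forall l l', (l < k)%nat -> (l' < k)%nat ->
     csum2 V d (fun v j => w l v j * w l' v j) = (if Nat.eqb l l' then 1 else 0)) /\
  (forall v i j, in_range V du d v i j ->
     A v i j = rsum k (fun l => sigma l * u l i * w l v j)).

Definition nucnorm (V du : nat) (d : nat -> nat) (A : cmat) : R :=
  epsilon (inhabits 0) (fun s => exists k sigma u w,
     is_svd V du d A k sigma u w /\ s = rsum k sigma).

Definition rank_decomp (V du : nat) (d : nat -> nat) (A : cmat) (k : nat) : Prop :=
  exists (u : nat -> nat -> R) (w : nat -> nat -> nat -> R),
    forall v i j, in_range V du d v i j -> A v i j = rsum k (fun l => u l i * w l v j).

Definition rk (V du : nat) (d : nat -> nat) (A : cmat) : nat :=
  epsilon (inhabits 0%nat) (fun k => rank_decomp V du d A k /\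
     forall k', rank_decomp V du d A k' -> (k <= k')%nat).

Definition supnorm_le (V du : nat) (d : nat -> nat) (W : cmat) (g : R) : Prop :=
  forall v i j, in_range V du d v i j -> Rabs (W v i j) <= g.

Definition wfrob2 (V du : nat) (d : nat -> nat) (pi : cmat) (A : cmat) : R :=
  csum3 V du d (fun v i j => pi v i j * (A v i j) ^ 2).

Definition cfg := nat -> nat -> nat -> bool.
Definition b2R (b : bool) : R := if b then 1 else 0.
Definition sgn (b : bool) : R := if b then 1 else -1.

Definition upd (c : cfg) (v i j : nat) (x : bool) : cfg :=
  fun v' i' j' => if (Nat.eqb v v' && Nat.eqb i i' && Nat.eqb j j')%bool then x
                  else c v' i' j'.

Definition idx_list (V du : nat) (d : nat -> nat) : list (nat * nat * nat) :=
  flat_map (fun v => flat_map (fun i => map (fun j => (v, i, j)) (seq 0 (d v)))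
                              (seq 0 du)) (seq 0 V).

(* Expectation of F(c) when the c(v,i,j), (v,i,j) in l, are independent Bernoulli(q v i j)
   (entries not in l are set to false). *)
Fixpoint Eprod (l : list (nat * nat * nat)) (q : cmat) (F : cfg -> R) : R :=
  match l with
  | nil => F (fun _ _ _ => false)
  | t :: l' =>
      let '(v, i, j) := t in
      q v i j * Eprod l' q (fun c => F (upd c v i j true))
      + (1 - q v i j) * Eprod l' q (fun c => F (upd c v i j false))
  end.

Definition indic (P : Prop) : R :=
  if excluded_middle_informative P then 1 else 0.

Definition SigmaR (V du : nat) (d : nat -> nat) (b e : cfg) : cmat :=
  fun v i j => / (INR du * INR (Dtot V d)) * (sgn (e v i j) * b2R (b v i j)).

Definition E_opnorm_SigmaR (V du : nat) (d : nat -> nat) (pi : cmat) : R :=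
  Eprod (idx_list V du d) pi (fun b =>
    Eprod (idx_list V du d) (fun _ _ _ => / 2) (fun e =>
      opnorm V du d (SigmaR V du d b e))).

(* observations: Y = B X, with x the values of X *)
Definition negloglik (V du : nat) (d : nat -> nat) (G : nat -> R -> R)
  (b : cfg) (x : cmat) (W : cmat) : R :=
  - / (INR du * INR (Dtot V d)) *
    csum3 V du d (fun v i j =>
      b2R (b v i j) * ((b2R (b v i j) * x v i j) * W v i j - G v (W v i j))).

Definition grad_negloglik (V du : nat) (d : nat -> nat) (G' : nat -> R -> R)
  (b : cfg) (x : cmat) (W : cmat) : cmat :=
  fun v i j => - / (INR du * INR (Dtot V d)) *
    (b2R (b v i j) * ((b2R (b v i j) * x v i j) - G' v (W v i j))).

Definition is_estimator (V du : nat) (d : nat -> nat) (G : nat -> R -> R)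
  (gamma lambda : R) (b : cfg) (x : cmat) (Mh : cmat) : Prop :=
  supnorm_le V du d Mh gamma /\
  forall W, supnorm_le V du d W gamma ->
    negloglik V du d G b x Mh + lambda * nucnorm V du d Mh
    <= negloglik V du d G b x W + lambda * nucnorm V du d W.

(* Main.v *)
(** Let [D] be the estimation error and [f = |D|_F].  Strong convexity of the likelihood,
    optimality of the estimator and a dual certificate for the nuclear norm at [M] give
    [L^2 / (2 n) * sum B D^2 <= 2 lambda sqrt (rk M) f] and the bound [6 sqrt (rk M) f] for
    the nuclear norm of [D], where [n = d_u D].  It remains to compare [sum B W^2] with
    [|W|_Pi^2], uniformly over bounded [W] with such a nuclear norm.  By homogeneity it is
    enough to treat [|W|_Pi^2 = T] with
    [T = 9216 (ln (d_u + D) + rk M (n E|Sigma_R|)^2) / p], and no peeling is needed.  The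
    supremum of [sum (pi - B) W^2] has expectation at most [T / 4] by symmetrization and
    contraction.  As a function of [B] it is one-sided Lipschitz with
    [sum W^4 <= sum W^2 <= T / p], so Maurey's infimum-convolution inequality on the discrete
    cube bounds the probability that it exceeds [T / 2] by [exp (- p T / 128)]. *)

Require Import Defs.
From Stdlib Require Import Reals Lra Lia List Arith Classical ClassicalEpsilon ClassicalDescription.
Import ListNotations.
Open Scope R_scope.

(** * Finite sums and inner products *)

(** The event concerns the sampling pattern [b] alone. For a good [b] the estimate follows
    deterministically, for every [x] compatible with [lambda] and every minimizer [Mh].

    The shape of the concentration part comes from one obstacle. A bounded-differences inequality
    would charge each entry with the largest [W t ^ 2] in the whole class, and the sum of these
    charges grows with the number of entries. Infimum-convolution accepts coefficients that depend
    on the point: at [b] only the maximizing [W] is charged. A maximum of functions affine in [b] is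
    Lipschitz in exactly this one-sided sense.

    The nuclear norm of the error is handled in its dual form [nuc_le]. This form comes straight out
    of the certificate argument, scales with the matrix, and can be tested directly against
    [SigmaR].

    The constant [9216] is [96 ^ 2] with [96 = 4 * 4 * 6]: the expectation must stay below [T / 4],
    contraction costs [4], and the nuclear norm bound carries [6]. *)

Definition lsum {I : Type} (l : list I) (f : I -> R) : R :=
  fold_right (fun i s => f i + s) 0 l.

Lemma lsum_cons {I} a (l : list I) f : lsum (a :: l) f = f a + lsum l f.
Proof. reflexivity. Qed.

Lemma lsum_ext {I} (l : list I) f g :
  (forall i, In i l -> f i = g i) -> lsum l f = lsum l g.
Proof.
  induction l as [|a l IH]; simpl; intros H; [reflexivity|].
  rewrite (H a (or_introl eq_refl)), IH; auto.
Qed.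

Lemma lsum_le {I} (l : list I) f g :
  (forall i, In i l -> f i <= g i) -> lsum l f <= lsum l g.
Proof.
  induction l as [|a l IH]; simpl; intros H; [lra|].
  pose proof (H a (or_introl eq_refl)).
  assert (lsum l f <= lsum l g) by auto. lra.
Qed.

Lemma lsum_zero {I} (l : list I) : lsum l (fun _ => 0) = 0.
Proof. induction l as [|a l IH]; simpl; [reflexivity|]. rewrite IH; ring. Qed.

Lemma lsum_nonneg {I} (l : list I) f :
  (forall i, In i l -> 0 <= f i) -> 0 <= lsum l f.
Proof. intros H. rewrite <- (lsum_zero l). now apply lsum_le. Qed.

Lemma lsum_plus {I} (l : list I) f g :
  lsum l (fun i => f i + g i) = lsum l f + lsum l g.
Proof. induction l as [|a l IH]; simpl; [ring|]. rewrite IH; ring. Qed.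

Lemma lsum_minus {I} (l : list I) f g :
  lsum l (fun i => f i - g i) = lsum l f - lsum l g.
Proof. induction l as [|a l IH]; simpl; [ring|]. rewrite IH; ring. Qed.

Lemma lsum_scal {I} (l : list I) c f :
  lsum l (fun i => c * f i) = c * lsum l f.
Proof. induction l as [|a l IH]; simpl; [ring|]. rewrite IH; ring. Qed.

Lemma lsum_const {I} (l : list I) c : lsum l (fun _ => c) = INR (length l) * c.
Proof.
  induction l as [|a l IH]; simpl lsum; [simpl; ring|].
  rewrite IH. simpl length. rewrite S_INR. ring.
Qed.

Lemma lsum_swap {I J} (l : list I) (m : list J) (f : I -> J -> R) :
  lsum l (fun i => lsum m (fun j => f i j)) = lsum m (fun j => lsum l (fun i => f i j)).
Proof.
  induction l as [|a l IH]; simpl.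
  - symmetry; apply lsum_zero.
  - rewrite IH, <- lsum_plus. reflexivity.
Qed.

Lemma lsum_app {I} (l m : list I) f : lsum (l ++ m) f = lsum l f + lsum m f.
Proof. induction l as [|a l IH]; simpl; [ring|]. rewrite IH; ring. Qed.

Lemma lsum_map {I J} (g : I -> J) (l : list I) f :
  lsum (map g l) f = lsum l (fun i => f (g i)).
Proof. induction l as [|a l IH]; simpl; [reflexivity|]. now rewrite IH. Qed.

Lemma lsum_flat_map {I J} (g : I -> list J) (l : list I) f :
  lsum (flat_map g l) f = lsum l (fun i => lsum (g i) f).
Proof. induction l as [|a l IH]; simpl; [reflexivity|]. now rewrite lsum_app, IH. Qed.

Lemma lsum_pairs {I J} (l : list I) (m : I -> list J) (f : I * J -> R) :
  lsum (flat_map (fun i => map (pair i) (m i)) l) f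
  = lsum l (fun i => lsum (m i) (fun j => f (i, j))).
Proof. rewrite lsum_flat_map. apply lsum_ext. intros. apply lsum_map. Qed.

Lemma lsum_ge_term {I} (l : list I) f a :
  (forall i, In i l -> 0 <= f i) -> In a l -> f a <= lsum l f.
Proof.
  induction l as [|b l IH]; simpl; intros H Ha; [contradiction|].
  assert (0 <= lsum l f) by (apply lsum_nonneg; auto).
  destruct Ha as [->|Ha]; [lra|].
  pose proof (H b (or_introl eq_refl)).
  assert (f a <= lsum l f) by auto. lra.
Qed.

Lemma lsum_delta (k m : nat) f : (m < k)%nat ->
  lsum (seq 0 k) (fun l => f l * (if Nat.eqb l m then 1 else 0)) = f m.
Proof.
  intros Hm.
  (* Induction on [k] passes through the values [k <= m], so the statement is first extended to
     them. *)
  assert (Hgen : forall k, lsum (seq 0 k) (fun l => f l * (if Nat.eqb l m then 1 else 0))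
                 = if Nat.ltb m k then f m else 0).
  { clear k Hm. induction k as [|k IH]; [reflexivity|].
    rewrite seq_S, lsum_app, IH. simpl.
    destruct (Nat.eqb_spec k m); destruct (Nat.ltb_spec m k); destruct (Nat.ltb_spec m (S k));
      try lia; subst; ring. }
  rewrite Hgen. destruct (Nat.ltb_spec m k); [reflexivity|lia].
Qed.

(** The squared norm of [s f - t g] is nonnegative for all [s], [t]. At [s = X], [t = A] it equals
    [A * (A * B - X ^ 2)], which suffices when [A > 0]. *)
Lemma lsum_CS {I} (l : list I) f g :
  (lsum l (fun i => f i * g i)) ^ 2
  <= lsum l (fun i => f i * f i) * lsum l (fun i => g i * g i).
Proof.
  set (A := lsum l (fun i => f i * f i)). set (X := lsum l (fun i => f i * g i)).
  set (B := lsum l (fun i => g i * g i)).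
  assert (Hq : forall s t, 0 <= s * s * A - 2 * s * t * X + t * t * B).
  { intros s t.
    replace (s * s * A - 2 * s * t * X + t * t * B)
      with (lsum l (fun i => (s * f i - t * g i) * (s * f i - t * g i))).
    - apply lsum_nonneg. intros i _. apply Rle_0_sqr.
    - unfold A, X, B. rewrite <- !lsum_scal, <- lsum_minus, <- lsum_plus.
      apply lsum_ext. intros; ring. }
  assert (HA : 0 <= A) by (apply lsum_nonneg; intros; nra).
  clearbody A X B.
  destruct (Req_dec A 0) as [E|E].
  - rewrite E.
    destruct (Req_dec X 0) as [EX|EX]; [rewrite EX; lra|].
    (* With [A = 0] the form is affine in [s]; for nonzero [X] this choice of [s] would give it the
       value [-1]. *)
    assert (HB := Hq ((B + 1) / (2 * X)) 1).
    rewrite E in HB. exfalso. replace (2 * ((B + 1) / (2 * X)) * 1 * X) with (B + 1) in HB by (field; lra).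
    nra.
  - assert (HX := Hq X A). assert (0 < A) by lra. nra.
Qed.

Lemma lsum_CS2 {I J} (l : list I) (m : list J) (f g : I -> J -> R) :
  (lsum l (fun i => lsum m (fun j => f i j * g i j))) ^ 2
  <= lsum l (fun i => lsum m (fun j => f i j * f i j))
     * lsum l (fun i => lsum m (fun j => g i j * g i j)).
Proof.
  pose proof (lsum_CS (flat_map (fun i => map (pair i) m) l)
                (fun c => f (fst c) (snd c)) (fun c => g (fst c) (snd c))) as H.
  rewrite !lsum_pairs in H. exact H.
Qed.

Lemma le_of_sq_le (X Y : R) : 0 <= Y -> X ^ 2 <= Y ^ 2 -> X <= Y.
Proof. intros; nra. Qed.

Definition dot {I} (l : list I) (x y : I -> R) : R := lsum l (fun i => x i * y i).
Definition mv {I J} (co : list J) (A : I -> J -> R) (x : J -> R) : I -> R :=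
  fun i => dot co (A i) x.
Definition tv {I J} (ro : list I) (A : I -> J -> R) (u : I -> R) : J -> R :=
  fun j => lsum ro (fun i => u i * A i j).
Definition ip {I J} (ro : list I) (co : list J) (A B : I -> J -> R) : R :=
  lsum ro (fun i => lsum co (fun j => A i j * B i j)).
Definition orth {I} (l : list I) (k : nat) (u : nat -> I -> R) : Prop :=
  forall a b, (a < k)%nat -> (b < k)%nat ->
    dot l (u a) (u b) = if Nat.eqb a b then 1 else 0.
Definition comb {I} (k : nat) (c : nat -> R) (u : nat -> I -> R) : I -> R :=
  fun i => lsum (seq 0 k) (fun l => c l * u l i).
(** For orthonormal [u], the projection onto the orthogonal complement of their span, not onto the
    span itself. *)
Definition proj {I} (l : list I) (k : nat) (u : nat -> I -> R) (x : I -> R) : I -> R :=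
  fun i => x i - comb k (fun a => dot l (u a) x) u i.

Lemma dot_ext {I} (l : list I) x y x' y' :
  (forall i, In i l -> x i = x' i) -> (forall i, In i l -> y i = y' i) ->
  dot l x y = dot l x' y'.
Proof. intros H H'. apply lsum_ext. intros i Hi. now rewrite H, H'. Qed.

Lemma dot_comm {I} (l : list I) x y : dot l x y = dot l y x.
Proof. apply lsum_ext; intros; ring. Qed.

Lemma dot_minus_r {I} (l : list I) x y z :
  dot l x (fun i => y i - z i) = dot l x y - dot l x z.
Proof. unfold dot. rewrite <- lsum_minus. apply lsum_ext; intros; ring. Qed.

Lemma dot_plus_r {I} (l : list I) x y z :
  dot l x (fun i => y i + z i) = dot l x y + dot l x z.
Proof. unfold dot. rewrite <- lsum_plus. apply lsum_ext; intros; ring. Qed.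

Lemma dot_scal_r {I} (l : list I) x c y :
  dot l x (fun i => c * y i) = c * dot l x y.
Proof. unfold dot. rewrite <- lsum_scal. apply lsum_ext; intros; ring. Qed.

Lemma dot_nonneg {I} (l : list I) x : 0 <= dot l x x.
Proof. apply lsum_nonneg; intros; nra. Qed.

Lemma dot_zero_inv {I} (l : list I) x : dot l x x <= 0 -> forall i, In i l -> x i = 0.
Proof.
  intros H i Hi.
  assert (x i * x i <= dot l x x).
  { apply (lsum_ge_term l (fun i => x i * x i)); auto. intros; nra. }
  nra.
Qed.

Lemma dot_CS {I} (l : list I) x y : (dot l x y) ^ 2 <= dot l x x * dot l y y.
Proof. apply lsum_CS. Qed.

Lemma dot_comb_r {I} (l : list I) k c u x :
  dot l x (comb k c u) = lsum (seq 0 k) (fun a => c a * dot l x (u a)).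
Proof.
  unfold dot, comb. erewrite lsum_ext by (intros; rewrite <- lsum_scal; reflexivity).
  rewrite lsum_swap. apply lsum_ext. intros a _. rewrite <- lsum_scal.
  apply lsum_ext; intros; ring.
Qed.

Lemma dot_comb_orth {I} (l : list I) k c u a : orth l k u -> (a < k)%nat ->
  dot l (u a) (comb k c u) = c a.
Proof.
  intros Ho Ha. rewrite dot_comb_r. rewrite <- (lsum_delta k a c Ha).
  apply lsum_ext. intros b Hb. apply in_seq in Hb.
  rewrite Ho by lia. now rewrite Nat.eqb_sym.
Qed.

Lemma dot_comb_comb {I} (l : list I) k c u : orth l k u ->
  dot l (comb k c u) (comb k c u) = lsum (seq 0 k) (fun a => c a * c a).
Proof.
  intros Ho. rewrite dot_comb_r. apply lsum_ext. intros a Ha. apply in_seq in Ha.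
  rewrite dot_comm, dot_comb_orth; auto; lia.
Qed.

Lemma dot_proj_orth {I} (l : list I) k u x a : orth l k u -> (a < k)%nat ->
  dot l (u a) (proj l k u x) = 0.
Proof.
  intros Ho Ha. unfold proj. rewrite dot_minus_r, dot_comb_orth by auto. ring.
Qed.

Lemma dot_comb_proj {I} (l : list I) k u c x : orth l k u ->
  dot l (comb k c u) (proj l k u x) = 0.
Proof.
  intros Ho. rewrite dot_comm, dot_comb_r. rewrite <- (lsum_zero (seq 0 k)).
  apply lsum_ext. intros a Ha. apply in_seq in Ha.
  rewrite dot_comm, dot_proj_orth; auto; [ring|lia].
Qed.

Lemma dot_proj_l {I} (l : list I) k u x y :
  dot l (proj l k u x) y = dot l x (proj l k u y).
Proof.
  rewrite dot_comm. unfold proj. rewrite !dot_minus_r, !dot_comb_r.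
  rewrite (dot_comm l y x). f_equal. apply lsum_ext. intros.
  rewrite (dot_comm l y), (dot_comm l x). ring.
Qed.

Lemma dot_plus_sq {I} (l : list I) x y : dot l x y = 0 ->
  dot l (fun i => x i + y i) (fun i => x i + y i) = dot l x x + dot l y y.
Proof.
  intros H. rewrite dot_plus_r, dot_comm, (dot_comm l _ y), !dot_plus_r.
  rewrite (dot_comm l y x), H. ring.
Qed.

Lemma pythagoras {I} (l : list I) k u x : orth l k u ->
  dot l x x = lsum (seq 0 k) (fun a => dot l (u a) x * dot l (u a) x)
              + dot l (proj l k u x) (proj l k u x).
Proof.
  intros Ho.
  rewrite <- (dot_comb_comb l k (fun a => dot l (u a) x) u Ho), <- dot_plus_sq.
  - unfold proj. apply dot_ext; intros; ring.
  - now apply dot_comb_proj.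
Qed.

Lemma proj_le {I} (l : list I) k u x : orth l k u ->
  dot l (proj l k u x) (proj l k u x) <= dot l x x.
Proof.
  intros Ho. rewrite (pythagoras l k u x Ho).
  assert (0 <= lsum (seq 0 k) (fun a => dot l (u a) x * dot l (u a) x)).
  { apply lsum_nonneg; intros; nra. }
  lra.
Qed.

Lemma bessel {I} (l : list I) k u x : orth l k u ->
  lsum (seq 0 k) (fun a => dot l (u a) x * dot l (u a) x) <= dot l x x.
Proof.
  intros Ho. rewrite (pythagoras l k u x Ho).
  pose proof (dot_nonneg l (proj l k u x)). lra.
Qed.

Lemma dot_tv {I J} (ro : list I) (co : list J) A u x :
  dot co (tv ro A u) x = dot ro u (mv co A x).
Proof.
  unfold dot, tv, mv, dot.
  erewrite lsum_ext by (intros; rewrite Rmult_comm, <- lsum_scal; reflexivity).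
  rewrite lsum_swap. apply lsum_ext. intros i _. rewrite <- lsum_scal.
  apply lsum_ext; intros; ring.
Qed.

(** Bessel's inequality in each row of [A]. Combined with Cauchy-Schwarz over [k] terms, it is the
    source of the factors [sqrt (INR k)] times a Frobenius norm. *)
Lemma lsum_mv_sq_le {I J} (ro : list I) (co : list J) A k w : orth co k w ->
  lsum (seq 0 k) (fun a => dot ro (mv co A (w a)) (mv co A (w a))) <= ip ro co A A.
Proof.
  intros Ho. unfold dot at 1. rewrite lsum_swap. apply lsum_le. intros i _.
  unfold mv. erewrite lsum_ext by (intros; rewrite dot_comm; reflexivity).
  apply (bessel co k w (A i) Ho).
Qed.

Lemma lsum_tv_sq_le {I J} (ro : list I) (co : list J) A k u : orth ro k u ->
  lsum (seq 0 k) (fun a => dot co (tv ro A (u a)) (tv ro A (u a))) <= ip ro co A A.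
Proof.
  intros Ho. unfold dot at 1. rewrite lsum_swap. unfold ip. rewrite (lsum_swap ro co).
  apply lsum_le. intros j _. apply (bessel ro k u (fun i => A i j) Ho).
Qed.

Lemma mv_sq_le {I J} (ro : list I) (co : list J) A x :
  dot ro (mv co A x) (mv co A x) <= ip ro co A A * dot co x x.
Proof.
  unfold ip. rewrite Rmult_comm, <- lsum_scal. apply lsum_le. intros i _.
  unfold mv. pose proof (dot_CS co (A i) x). unfold dot in *. lra.
Qed.

(** * Singular value decompositions *)

Definition incr (phi : nat -> nat) : Prop := forall n, (phi n < phi (S n))%nat.

Lemma incr_ge phi : incr phi -> forall n, (n <= phi n)%nat.
Proof. intros H n. induction n; [lia|]. pose proof (H n). lia. Qed.

Lemma incr_lt phi : incr phi -> forall m n, (m < n)%nat -> (phi m < phi n)%nat.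
Proof.
  intros H m n Hmn. induction Hmn; [apply H|].
  pose proof (H m0). lia.
Qed.

Lemma incr_comp phi psi : incr phi -> incr psi -> incr (fun n => phi (psi n)).
Proof. intros H H' n. apply incr_lt; auto. Qed.

Lemma Un_cv_subseq un l phi : incr phi -> Un_cv un l -> Un_cv (fun n => un (phi n)) l.
Proof.
  intros H Hu eps He. destruct (Hu eps He) as [N HN]. exists N. intros n Hn.
  apply HN. pose proof (incr_ge phi H n). lia.
Qed.

(** The library theorem yields a cluster value [l]. The subsequence is chosen recursively: each
    index lies beyond the previous one, with its term within [/ INR (S n)] of [l]. *)
Lemma bolzano_weierstrass_seq (un : nat -> R) (B : R) :
  (forall n, Rabs (un n) <= B) -> exists phi l, incr phi /\ Un_cv (fun n => un (phi n)) l.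
Proof.
  intros HB.
  destruct (Bolzano_Weierstrass un (fun c => - B <= c <= B)) as [l Hl].
  - apply compact_P3.
  - intros n. pose proof (HB n). pose proof (Rle_abs (un n)).
    pose proof (Rle_abs (- un n)). rewrite Rabs_Ropp in H1. lra.
  - assert (Hnext : forall N n : nat, exists p, (N < p)%nat /\ Rabs (un p - l) < / INR (S n)).
    { intros N n.
      assert (Hp : 0 < / INR (S n)) by (apply Rinv_0_lt_compat, lt_0_INR; lia).
      destruct (Hl (disc l (mkposreal _ Hp)) (S N)) as [p [Hp1 Hp2]].
      - exists (mkposreal _ Hp). intros x Hx; exact Hx.
      - exists p. split; [lia|]. exact Hp2. }
    pose (next := fun N n => proj1_sig (constructive_indefinite_description _ (Hnext N n))).
    assert (Hn : forall N n, (N < next N n)%nat /\ Rabs (un (next N n) - l) < / INR (S n)).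
    { intros N n. unfold next. now destruct constructive_indefinite_description. }
    pose (phi := fix phi n := match n with O => next O O | S m => next (phi m) (S m) end).
    exists phi, l. split.
    + intros n. simpl. apply Hn.
    + intros eps He.
      destruct (archimed_cor1 eps He) as [N [HN HN0]]. exists N. intros n Hge.
      assert (Rabs (un (phi n) - l) < / INR (S n)) by (destruct n; apply Hn).
      unfold Rdist. eapply Rlt_trans; [exact H|]. eapply Rle_lt_trans; [|exact HN].
      apply Rinv_le_contravar; [apply lt_0_INR; lia|apply le_INR; lia].
Qed.

Lemma bolzano_weierstrass_vec {I} (l : list I) (xs : nat -> I -> R) (B : R) :
  (forall n i, In i l -> Rabs (xs n i) <= B) ->
  exists phi x, incr phi /\ forall i, In i l -> Un_cv (fun n => xs (phi n) i) (x i).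
Proof.
  induction l as [|a l IH]; intros HB.
  - exists (fun n => n), (fun _ => 0). split; [intros n; lia|contradiction].
  - destruct IH as (phi & x & Hphi & Hx); [intros; apply HB; now right|].
    destruct (bolzano_weierstrass_seq (fun n => xs (phi n) a) B) as (psi & la & Hpsi & Hla).
    { intros n. apply HB. now left. }
    exists (fun n => phi (psi n)).
    (* The index [a] may occur again in the tail. The new limit then overrides the old one,
       consistently, because the last subsequence was extracted for coordinate [a]. *)
    exists (fun i => if excluded_middle_informative (i = a) then la else x i).
    split; [now apply incr_comp|].
    intros i Hi. destruct excluded_middle_informative as [->|Hne]; [exact Hla|].
    destruct Hi as [Hi|Hi]; [congruence|].
    apply (Un_cv_subseq (fun n => xs (phi n) i)); auto.
Qed.

Lemma Un_cv_const c : Un_cv (fun _ => c) c.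
Proof.
  intros eps He. exists O. intros. unfold Rdist. rewrite Rminus_diag, Rabs_R0. exact He.
Qed.

Lemma Un_cv_lsum {I} (l : list I) (f : nat -> I -> R) g :
  (forall i, In i l -> Un_cv (fun n => f n i) (g i)) ->
  Un_cv (fun n => lsum l (f n)) (lsum l g).
Proof.
  induction l as [|a l IH]; intros H; simpl.
  - apply Un_cv_const.
  - apply (CV_plus (fun n => f n a) (fun n => lsum l (f n))).
    + apply H; now left.
    + apply IH; intros; apply H; now right.
Qed.

Lemma normalize {J} (co : list J) (y : J -> R) : 0 < dot co y y ->
  let z := fun j => / sqrt (dot co y y) * y j in
  dot co z z = 1.
Proof.
  intros H z. unfold z.
  assert (Hs := sqrt_lt_R0 _ H). pose proof (sqrt_sqrt _ (Rlt_le _ _ H)) as Hq.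
  set (s := sqrt (dot co y y)) in *. clearbody s.
  rewrite dot_scal_r, dot_comm, dot_scal_r, <- Hq. field. lra.
Qed.

(** Compactness of the unit sphere: a maximizing sequence has a coordinatewise convergent
    subsequence, and both quadratic forms pass to the limit. The vector [y0] guarantees that the
    sphere is nonempty. *)
Lemma sphere_max {I J} (ro : list I) (co : list J) (A : I -> J -> R) (y0 : J -> R) :
  0 < dot co y0 y0 ->
  exists x, dot co x x = 1 /\
    forall y, dot co y y = 1 -> dot ro (mv co A y) (mv co A y) <= dot ro (mv co A x) (mv co A x).
Proof.
  intros Hy0.
  pose (S := fun t => exists y, dot co y y = 1 /\ t = dot ro (mv co A y) (mv co A y)).
  destruct (completeness S) as [m [Hub Hlub]].
  - exists (ip ro co A A). intros t (y & Hy & ->).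
    pose proof (mv_sq_le ro co A y). rewrite Hy in H. lra.
  - eexists. eexists. split; [exact (normalize co y0 Hy0)|reflexivity].
  - assert (Hn : forall n : nat, exists y, dot co y y = 1 /\
               m - / INR (Datatypes.S n) < dot ro (mv co A y) (mv co A y)).
    { intros n. apply NNPP. intros Hc.
      assert (Hp : 0 < / INR (Datatypes.S n)) by (apply Rinv_0_lt_compat, lt_0_INR; lia).
      assert (m <= m - / INR (Datatypes.S n)); [|lra].
      apply Hlub. intros t (y & Hy & ->). apply Rnot_lt_le. intros Hlt. apply Hc.
      exists y. split; auto. }
    pose (ys := fun n => proj1_sig (constructive_indefinite_description _ (Hn n))).
    assert (Hys : forall n, dot co (ys n) (ys n) = 1 /\
               m - / INR (Datatypes.S n) < dot ro (mv co A (ys n)) (mv co A (ys n))).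
    { intros n. unfold ys. now destruct constructive_indefinite_description. }
    destruct (bolzano_weierstrass_vec co ys 1) as (phi & x & Hphi & Hx).
    { intros n j Hj. destruct (Hys n) as [H1 _].
      assert (ys n j * ys n j <= 1).
      { rewrite <- H1. apply (lsum_ge_term co (fun j => ys n j * ys n j)); auto.
        intros; apply Rle_0_sqr. }
      apply Rabs_le. nra. }
    assert (Hdot : Un_cv (fun n => dot co (ys (phi n)) (ys (phi n))) (dot co x x)).
    { unfold dot. apply Un_cv_lsum. intros. apply CV_mult; auto. }
    assert (HA : Un_cv (fun n => dot ro (mv co A (ys (phi n))) (mv co A (ys (phi n))))
                   (dot ro (mv co A x) (mv co A x))).
    { assert (forall i, Un_cv (fun n => mv co A (ys (phi n)) i) (mv co A x i)).
      { intros i. unfold mv, dot. apply Un_cv_lsum. intros. apply CV_mult; auto.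
        apply Un_cv_const. }
      unfold dot at 1. apply (Un_cv_lsum ro
        (fun n i => mv co A (ys (phi n)) i * mv co A (ys (phi n)) i)).
      intros. apply CV_mult; auto. }
    exists x. split.
    + eapply UL_sequence; [exact Hdot|].
      intros eps He. exists O. intros n _. rewrite (proj1 (Hys (phi n))).
      unfold Rdist. rewrite Rminus_diag, Rabs_R0. exact He.
    + intros y Hy.
      assert (dot ro (mv co A y) (mv co A y) <= m) by (apply Hub; exists y; auto).
      apply Rle_trans with (1 := H). apply Rnot_lt_le. intros Hlt.
      destruct (HA ((m - dot ro (mv co A x) (mv co A x)) / 2)) as [N HN]; [lra|].
      destruct (archimed_cor1 ((m - dot ro (mv co A x) (mv co A x)) / 2)) as [N' [HN' HN'0]]; [lra|].
      specialize (HN (N + N')%nat ltac:(lia)).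
      destruct (Hys (phi (N + N')%nat)) as [_ Hlow].
      assert (/ INR (Datatypes.S (phi (N + N')%nat)) <= / INR N').
      { apply Rinv_le_contravar; [apply lt_0_INR; lia|apply le_INR].
        pose proof (incr_ge phi Hphi (N + N')%nat). lia. }
      unfold Rdist in HN. apply Rabs_def2 in HN. lra.
Qed.

Lemma dot_sq_le_gen {I J} (ro : list I) (co : list J) A (s : R) :
  (forall y, dot co y y = 1 -> dot ro (mv co A y) (mv co A y) <= s) ->
  forall y, dot ro (mv co A y) (mv co A y) <= s * dot co y y.
Proof.
  intros H y. destruct (Rle_lt_dec (dot co y y) 0) as [H0|H0].
  - assert (Hz := dot_zero_inv co y H0).
    assert (dot co y y = 0) by (pose proof (dot_nonneg co y); lra).
    pose proof (mv_sq_le ro co A y). rewrite H1 in *. lra.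
  - pose proof (H _ (normalize co y H0)) as Hn. cbv zeta in Hn.
    pose proof (sqrt_lt_R0 _ H0) as Hs. pose proof (sqrt_sqrt _ (Rlt_le _ _ H0)) as Hq.
    set (q := sqrt (dot co y y)) in *.
    assert (E : dot ro (mv co A (fun j => / q * y j)) (mv co A (fun j => / q * y j))
             = / q * (/ q * dot ro (mv co A y) (mv co A y))).
    { change (dot ro (mv co A y) (mv co A y)) with (lsum ro (fun i => mv co A y i * mv co A y i)).
      rewrite <- !lsum_scal. apply lsum_ext. intros i _.
      unfold mv. rewrite dot_scal_r. ring. }
    rewrite E in Hn. rewrite <- Hq.
    apply Rmult_le_reg_l with (/ q * / q).
    { apply Rmult_lt_0_compat; apply Rinv_0_lt_compat; lra. }
    replace (/ q * / q * (s * (q * q))) with s by (field; lra). lra.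
Qed.

(** Take [x] maximizing the norm of [A x] on the sphere, [s] the maximum and [u = A x / s]. The
    relation for the transpose is the equality case of Cauchy-Schwarz: [y = tv ro A u] has inner
    product [s] with the unit vector [x] and norm at most [s], so [y - s x] has squared norm at most
    [0]. *)
Lemma top_singular {I J} (ro : list I) (co : list J) (A : I -> J -> R) i0 j0 :
  In i0 ro -> In j0 co -> A i0 j0 <> 0 ->
  exists s u x, 0 < s /\ dot ro u u = 1 /\ dot co x x = 1 /\
    (forall i, mv co A x i = s * u i) /\ (forall j, In j co -> tv ro A u j = s * x j).
Proof.
  intros Hi Hj HA.
  assert (Hpos : 0 < dot co (A i0) (A i0)).
  { apply Rlt_le_trans with (A i0 j0 * A i0 j0); [nra|].
    apply (lsum_ge_term co (fun j => A i0 j * A i0 j)); auto. intros; apply Rle_0_sqr. }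
  destruct (sphere_max ro co A (A i0) Hpos) as (x & Hx & Hmax).
  set (m := dot ro (mv co A x) (mv co A x)) in *.
  assert (Hgen := dot_sq_le_gen ro co A m Hmax).
  (* The nonzero row [A i0] serves as test vector: entry [i0] of its image is its own squared
     norm. *)
  assert (Hm : 0 < m).
  { assert (mv co A (A i0) i0 * mv co A (A i0) i0 <= m * dot co (A i0) (A i0)).
    { eapply Rle_trans; [|apply Hgen].
      apply (lsum_ge_term ro (fun i => mv co A (A i0) i * mv co A (A i0) i)); auto.
      intros; apply Rle_0_sqr. }
    unfold mv in H. apply Rmult_lt_reg_r with (dot co (A i0) (A i0)); [exact Hpos|]. nra. }
  pose proof (sqrt_lt_R0 _ Hm) as Hs. pose proof (sqrt_sqrt _ (Rlt_le _ _ Hm)) as Hq.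
  set (s := sqrt m) in *.
  set (u := fun i => / s * mv co A x i).
  assert (Hu : dot ro u u = 1).
  { unfold u, s. exact (normalize ro (mv co A x) Hm). }
  assert (HAx : forall i, mv co A x i = s * u i) by (intros; unfold u; field; lra).
  exists s, u, x. repeat split; auto.
  assert (Hyx : dot co (tv ro A u) x = s).
  { rewrite dot_tv. erewrite dot_ext; [|reflexivity|intros; apply HAx].
    rewrite dot_scal_r, Hu. ring. }
  (* The squared norm of [y] is the inner product of [u] with [A y], hence at most [s] times the
     norm of [y]. *)
  assert (Hyy : dot co (tv ro A u) (tv ro A u) <= s * s).
  { set (y := tv ro A u) in *.
    assert (dot co y y ^ 2 <= 1 * (m * dot co y y)).
    { unfold y at 1. rewrite dot_tv. eapply Rle_trans; [apply dot_CS|].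
      rewrite Hu. pose proof (Hgen y). lra. }
    pose proof (dot_nonneg co y). rewrite Hq. nra. }
  intros j Hj'.
  apply Rminus_diag_uniq.
  apply (dot_zero_inv co (fun j => tv ro A u j - s * x j)); auto.
  rewrite dot_minus_r, dot_comm, (dot_comm _ _ (fun i => s * x i)), !dot_minus_r.
  rewrite (dot_comm _ (fun i => s * x i)), !dot_scal_r.
  rewrite (dot_comm co (fun i => s * x i)), !dot_scal_r.
  rewrite Hx, Hyx. lra.
Qed.

(** Gaussian elimination: if equation [r] has a nonzero coefficient at [l0], it eliminates that
    unknown from the others. Otherwise it holds for every [z]. *)
Lemma homogeneous_solution (r : nat) : forall (C : nat -> nat -> R) (ls : list nat),
  NoDup ls -> (r < length ls)%nat ->
  exists z : nat -> R, (exists l, In l ls /\ z l <> 0) /\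
    forall m, (m < r)%nat -> lsum ls (fun l => C m l * z l) = 0.
Proof.
  induction r as [|r IH]; intros C ls Hnd Hlen.
  - destruct ls as [|a ls]; [simpl in Hlen; lia|].
    exists (fun _ => 1). split; [|lia]. exists a. split; [now left|lra].
  - destruct (classic (exists l0, In l0 ls /\ C r l0 <> 0)) as [(l0 & Hin & Hc)|Hall].
    + destruct (in_split l0 ls Hin) as (l1 & l2 & E). subst ls.
      assert (Hnotin := NoDup_remove_2 _ _ _ Hnd). apply NoDup_remove_1 in Hnd.
      rewrite length_app in Hlen. simpl in Hlen.
      destruct (IH (fun m l => C m l - C m l0 * C r l / C r l0) (l1 ++ l2) Hnd)
        as (z & (l & Hl & Hz) & Hsol).
      { rewrite length_app. lia. }
      set (z0 := - lsum (l1 ++ l2) (fun l => C r l * z l) / C r l0).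
      exists (fun l => if Nat.eqb l l0 then z0 else z l).
      assert (Hsum : forall m, lsum (l1 ++ l0 :: l2)
                 (fun l => C m l * (if Nat.eqb l l0 then z0 else z l))
               = C m l0 * z0 + lsum (l1 ++ l2) (fun l => C m l * z l)).
      { intros m. rewrite lsum_app. simpl. rewrite Nat.eqb_refl.
        rewrite (lsum_ext (l1 ++ l2) (fun l => C m l * z l)
                  (fun l => C m l * (if Nat.eqb l l0 then z0 else z l))).
        - rewrite lsum_app. ring.
        - intros l' Hl'. destruct (Nat.eqb_spec l' l0); [subst; contradiction|reflexivity]. }
      split.
      * exists l. split.
        -- apply in_app_iff in Hl. apply in_app_iff. simpl. tauto.
        -- destruct (Nat.eqb_spec l l0); [subst; contradiction|auto].
      * intros m Hm. rewrite Hsum. destruct (Nat.eq_dec m r) as [->|Hne].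
        -- unfold z0. field. exact Hc.
        -- rewrite <- (Hsol m) by lia. unfold z0.
           rewrite (lsum_ext (l1 ++ l2) (fun l' => (C m l' - C m l0 * C r l' / C r l0) * z l')
             (fun l' => C m l' * z l' - (C m l0 / C r l0) * (C r l' * z l'))).
           ++ rewrite lsum_minus, lsum_scal. field. exact Hc.
           ++ intros. field. exact Hc.
    + destruct (IH C ls Hnd) as (z & Hz & Hsol); [lia|].
      exists z. split; [exact Hz|]. intros m Hm.
      destruct (Nat.eq_dec m r) as [->|Hne]; [|apply Hsol; lia].
      rewrite <- (lsum_zero ls). apply lsum_ext. intros l Hl.
      destruct (Req_dec (C r l) 0) as [E|E]; [rewrite E; ring|].
      exfalso. apply Hall. now exists l.
Qed.

(** If [k > r], some nonzero [z] is annihilated by [C], so the combination of the [u l] with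
    coefficients [z l] vanishes on [ro]. Its inner product with [u l] is [z l], a contradiction. *)
Lemma orth_rank_le {I} (ro : list I) k r u (a : nat -> I -> R) (C : nat -> nat -> R) :
  orth ro k u ->
  (forall l i, (l < k)%nat -> In i ro -> u l i = lsum (seq 0 r) (fun m => C m l * a m i)) ->
  (k <= r)%nat.
Proof.
  intros Ho Hu. apply Nat.nlt_ge. intros Hlt.
  destruct (homogeneous_solution r C (seq 0 k)) as (z & (l & Hl & Hz) & Hsol).
  { apply seq_NoDup. }
  { now rewrite length_seq. }
  apply Hz. apply in_seq in Hl.
  rewrite <- (dot_comb_orth ro k z u l Ho) by lia.
  unfold dot. rewrite <- (lsum_zero ro). apply lsum_ext. intros i Hi.
  replace (comb k z u i) with 0; [ring|]. symmetry.
  unfold comb. transitivity (lsum (seq 0 r) (fun m => a m i * lsum (seq 0 k) (fun l => C m l * z l))).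
  - erewrite lsum_ext; [|intros b Hb; apply in_seq in Hb; rewrite (Hu b i) by (auto; lia);
                         rewrite <- lsum_scal; reflexivity].
    rewrite lsum_swap. apply lsum_ext. intros m _. rewrite <- lsum_scal.
    apply lsum_ext. intros; ring.
  - rewrite <- (lsum_zero (seq 0 r)). apply lsum_ext. intros m Hm. apply in_seq in Hm.
    rewrite Hsol by lia. ring.
Qed.

Lemma orth_dim_le (n : nat) k u : orth (seq 0 n) k u -> (k <= n)%nat.
Proof.
  intros Ho.
  apply (orth_rank_le (seq 0 n) k n u (fun m i => if Nat.eqb m i then 1 else 0) (fun m l => u l m) Ho).
  intros l i Hl Hi. apply in_seq in Hi. symmetry.
  apply (lsum_delta n i (fun m => u l m)). lia.
Qed.

Definition svd {I J} (ro : list I) (co : list J) (A : I -> J -> R) (k : nat)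
    (sigma : nat -> R) (u : nat -> I -> R) (w : nat -> J -> R) : Prop :=
  (forall l, (l < k)%nat -> 0 < sigma l) /\ orth ro k u /\ orth co k w /\
  (forall i j, In i ro -> In j co ->
     A i j = lsum (seq 0 k) (fun l => sigma l * u l i * w l j)).

Lemma orth_snoc {I} (l : list I) k u x : orth l k u -> dot l x x = 1 ->
  (forall a, (a < k)%nat -> dot l (u a) x = 0) ->
  orth l (S k) (fun a => if Nat.eqb a k then x else u a).
Proof.
  intros Ho Hx Hux a b Ha Hb.
  destruct (Nat.eqb_spec a k), (Nat.eqb_spec b k); destruct (Nat.eqb_spec a b); subst; try lia; auto.
  - rewrite dot_comm. apply Hux. lia.
  - apply Hux. lia.
  - rewrite Ho by lia. now rewrite Nat.eqb_refl.
  - rewrite Ho by lia. destruct (Nat.eqb_spec a b); [contradiction|reflexivity].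
Qed.

(** Deflation: split off a top singular pair while the remainder [R] is nonzero. If this never
    stopped, it would produce [n + 1] orthonormal vectors in dimension [n]. *)
Lemma svd_exists {J} (n : nat) (co : list J) (A : nat -> J -> R) :
  exists k sigma u w, svd (seq 0 n) co A k sigma u w.
Proof.
  set (ro := seq 0 n). apply NNPP. intros Hno.
  assert (Hpart : forall k, exists sigma u w (R : nat -> J -> R),
    (forall l, (l < k)%nat -> 0 < sigma l) /\ orth ro k u /\ orth co k w /\
    (forall i j, In i ro -> In j co ->
       A i j = lsum (seq 0 k) (fun l => sigma l * u l i * w l j) + R i j) /\
    (forall l i, (l < k)%nat -> In i ro -> mv co R (w l) i = 0) /\
    (forall l j, (l < k)%nat -> In j co -> tv ro R (u l) j = 0)).
  { induction k as [|k IH].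
    - exists (fun _ => 0), (fun _ _ => 0), (fun _ _ => 0), A.
      repeat split; try (intros; lia); try (intros ? ?; lia). intros; simpl; ring.
    - destruct IH as (sigma & u & w & R & Hs & Hu & Hw & HA & HR & HRt).
      destruct (classic (exists i0 j0, In i0 ro /\ In j0 co /\ R i0 j0 <> 0))
        as [(i0 & j0 & Hi0 & Hj0 & HR0)|Hz].
      + destruct (top_singular ro co R i0 j0 Hi0 Hj0 HR0)
          as (s & u' & x & Hspos & Hu' & Hx & HRx & HRu).
        (* [R] annihilates the earlier singular vectors on both sides, and [s u'] is in the range of
           [R]; moving [R] across the inner product gives orthogonality. *)
        assert (Hux : forall a, (a < k)%nat -> dot ro (u a) u' = 0).
        { intros a Ha. apply Rmult_eq_reg_l with s; [|lra]. rewrite Rmult_0_r, <- dot_scal_r.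
          rewrite (dot_ext ro (u a) (fun i => s * u' i) (u a) (mv co R x))
            by (intros; auto).
          rewrite <- dot_tv. rewrite <- (lsum_zero co). apply lsum_ext. intros j Hj.
          rewrite HRt by auto. ring. }
        assert (Hwx : forall a, (a < k)%nat -> dot co (w a) x = 0).
        { intros a Ha. apply Rmult_eq_reg_l with s; [|lra]. rewrite Rmult_0_r, <- dot_scal_r.
          rewrite (dot_ext co (w a) (fun i => s * x i) (w a) (tv ro R u'))
            by (intros; auto; symmetry; auto).
          rewrite dot_comm, dot_tv, <- (lsum_zero ro). apply lsum_ext. intros i Hi.
          rewrite HR by auto. ring. }
        exists (fun a => if Nat.eqb a k then s else sigma a),
               (fun a => if Nat.eqb a k then u' else u a),
               (fun a => if Nat.eqb a k then x else w a),
               (fun i j => R i j - s * u' i * x j).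
        assert (Hmv : forall y i, mv co (fun i j => R i j - s * u' i * x j) y i
                   = mv co R y i - s * u' i * dot co x y).
        { intros y i. unfold mv. rewrite dot_comm, dot_minus_r, dot_scal_r.
          now rewrite (dot_comm co y (R i)), (dot_comm co y x). }
        assert (Htv : forall y j, tv ro (fun i j => R i j - s * u' i * x j) y j
                   = tv ro R y j - s * x j * dot ro y u').
        { intros y j. unfold tv, dot. rewrite <- lsum_scal, <- lsum_minus.
          apply lsum_ext; intros; ring. }
        split; [|split; [|split; [|split; [|split]]]].
        * intros l Hl. destruct (Nat.eqb_spec l k); [auto|apply Hs; lia].
        * apply orth_snoc; auto.
        * apply orth_snoc; auto.
        * intros i j Hi Hj. rewrite seq_S, lsum_app. simpl. rewrite Nat.eqb_refl.
          rewrite HA by auto. rewrite (lsum_ext (seq 0 k)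
            (fun l => sigma l * u l i * w l j)
            (fun l => (if l =? k then s else sigma l) * (if l =? k then u' else u l) i
                      * (if l =? k then x else w l) j)).
          -- ring.
          -- intros l Hl. apply in_seq in Hl. destruct (Nat.eqb_spec l k); [lia|reflexivity].
        * intros l i Hl Hi. rewrite Hmv. destruct (Nat.eqb_spec l k).
          -- rewrite HRx, Hx. ring.
          -- rewrite HR by (auto; lia). rewrite dot_comm, Hwx by lia. ring.
        * intros l j Hl Hj. rewrite Htv. destruct (Nat.eqb_spec l k).
          -- rewrite HRu, Hu' by auto. ring.
          -- rewrite HRt by (auto; lia). rewrite Hux by lia. ring.
      + exfalso. apply Hno. exists k, sigma, u, w. split; [|split; [|split]]; auto.
        intros i j Hi Hj. rewrite HA by auto.
        destruct (Req_dec (R i j) 0) as [E|E]; [rewrite E; ring|].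
        exfalso. apply Hz. now exists i, j. }
  destruct (Hpart (S n)) as (sigma & u & w & R & _ & Hu & _).
  apply orth_dim_le in Hu. lia.
Qed.

(** * Nuclear norm duality *)

Definition op_le {I J} (ro : list I) (co : list J) (A : I -> J -> R) (s : R) : Prop :=
  0 <= s /\ forall x, dot ro (mv co A x) (mv co A x) <= s ^ 2 * dot co x x.

(** A nuclear norm bound in its dual form, by trace pairing with matrices of bounded operator
    norm. *)
Definition nuc_le {I J} (ro : list I) (co : list J) (A : I -> J -> R) (N : R) : Prop :=
  forall Z s, op_le ro co Z s -> ip ro co Z A <= s * N.

(** The matrix [U W^T], the part common to all subgradients of the nuclear norm at a matrix with
    these singular vectors. *)
Definition iso {I J} k (u : nat -> I -> R) (w : nat -> J -> R) : I -> J -> R :=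
  fun i j => lsum (seq 0 k) (fun l => u l i * w l j).

Definition rowproj {I J} (co : list J) k (w : nat -> J -> R) (Z : I -> J -> R) : I -> J -> R :=
  fun i => proj co k w (Z i).

(** For orthonormal families this is [(I - U U^T) Z (I - W W^T)]. *)
Definition perp {I J} (ro : list I) (co : list J) k (u : nat -> I -> R) (w : nat -> J -> R)
    (Z : I -> J -> R) : I -> J -> R :=
  fun i j => proj ro k u (fun i' => rowproj co k w Z i' j) i.

Lemma ip_plus_l {I J} (ro : list I) (co : list J) A B C :
  ip ro co (fun i j => A i j + B i j) C = ip ro co A C + ip ro co B C.
Proof.
  unfold ip. rewrite <- lsum_plus. apply lsum_ext. intros i _.
  rewrite <- lsum_plus. apply lsum_ext; intros; ring.
Qed.

Lemma ip_scal_l {I J} (ro : list I) (co : list J) c A C :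
  ip ro co (fun i j => c * A i j) C = c * ip ro co A C.
Proof.
  unfold ip. rewrite <- lsum_scal. apply lsum_ext. intros i _.
  rewrite <- lsum_scal. apply lsum_ext; intros; ring.
Qed.

Lemma ip_comm {I J} (ro : list I) (co : list J) A B : ip ro co A B = ip ro co B A.
Proof. unfold ip. apply lsum_ext; intros. apply lsum_ext; intros; ring. Qed.

Lemma ip_ext {I J} (ro : list I) (co : list J) A B C D :
  (forall i j, In i ro -> In j co -> A i j = C i j) ->
  (forall i j, In i ro -> In j co -> B i j = D i j) -> ip ro co A B = ip ro co C D.
Proof.
  intros H H'. apply lsum_ext. intros i Hi. apply lsum_ext. intros j Hj.
  now rewrite H, H'.
Qed.

Lemma ip_lsum_l {I J} (ro : list I) (co : list J) k (F : nat -> I -> J -> R) C :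
  ip ro co (fun i j => lsum (seq 0 k) (fun l => F l i j)) C
  = lsum (seq 0 k) (fun l => ip ro co (F l) C).
Proof.
  unfold ip. rewrite (lsum_swap (seq 0 k) ro). apply lsum_ext. intros i _.
  rewrite (lsum_swap (seq 0 k) co). apply lsum_ext. intros j _.
  rewrite Rmult_comm, <- lsum_scal. apply lsum_ext; intros; ring.
Qed.

Lemma ip_outer_l {I J} (ro : list I) (co : list J) u w C :
  ip ro co (fun i j => u i * w j) C = dot ro u (mv co C w).
Proof.
  apply lsum_ext. intros i _. unfold mv, dot. rewrite <- lsum_scal.
  apply lsum_ext; intros; ring.
Qed.

Lemma ip_nonneg {I J} (ro : list I) (co : list J) A : 0 <= ip ro co A A.
Proof. apply lsum_nonneg; intros; apply lsum_nonneg; intros; apply Rle_0_sqr. Qed.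

Lemma dot_unit_le {I J} (ro : list I) (co : list J) Z s u w :
  op_le ro co Z s -> dot ro u u = 1 -> dot co w w = 1 -> dot ro u (mv co Z w) <= s.
Proof.
  intros [Hs HZ] Hu Hw. apply le_of_sq_le; [exact Hs|].
  eapply Rle_trans; [apply dot_CS|]. rewrite Hu. pose proof (HZ w). rewrite Hw in H. lra.
Qed.

Lemma ip_svd_le {I J} (ro : list I) (co : list J) A k sigma u w Z :
  svd ro co A k sigma u w -> op_le ro co Z 1 -> ip ro co A Z <= lsum (seq 0 k) sigma.
Proof.
  intros (Hs & Hu & Hw & HA) HZ.
  rewrite (ip_ext ro co A Z (fun i j => lsum (seq 0 k) (fun l => sigma l * (u l i * w l j))) Z);
    [|intros; rewrite HA by auto; apply lsum_ext; intros; ring|reflexivity].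
  rewrite (ip_lsum_l ro co k (fun l i j => sigma l * (u l i * w l j))).
  apply lsum_le. intros l Hl. apply in_seq in Hl. rewrite ip_scal_l, ip_outer_l.
  assert (dot ro (u l) (mv co Z (w l)) <= 1).
  { apply (dot_unit_le ro co Z 1); auto.
    - rewrite Hu, Nat.eqb_refl by lia. reflexivity.
    - rewrite Hw, Nat.eqb_refl by lia. reflexivity. }
  pose proof (Hs l ltac:(lia)). nra.
Qed.

Lemma mv_iso {I J} (co : list J) k (u : nat -> I -> R) w x i :
  mv co (iso k u w) x i = comb k (fun l => dot co (w l) x) u i.
Proof.
  unfold mv. rewrite dot_comm. unfold iso, comb.
  rewrite (dot_ext co x (fun j => lsum (seq 0 k) (fun l => u l i * w l j))
             x (comb k (fun l => u l i) w)) by reflexivity.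
  rewrite dot_comb_r. apply lsum_ext. intros l _. rewrite (dot_comm co x). ring.
Qed.

Lemma mv_perp {I J} (ro : list I) (co : list J) k u w Z x i :
  mv co (perp ro co k u w Z) x i = proj ro k u (mv co Z (proj co k w x)) i.
Proof.
  set (Z1 := rowproj co k w Z).
  assert (E : forall i', mv co Z (proj co k w x) i' = mv co Z1 x i')
    by (intros; symmetry; apply dot_proj_l).
  unfold proj at 1. rewrite E.
  change (mv co (perp ro co k u w Z) x i)
    with (lsum co (fun j => (Z1 i j - comb k (fun l => tv ro Z1 (u l) j) u i) * x j)).
  rewrite (lsum_ext co _ (fun j => Z1 i j * x j
             - lsum (seq 0 k) (fun l => u l i * (tv ro Z1 (u l) j * x j)))).
  - rewrite lsum_minus, (lsum_swap co). f_equal.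
    unfold comb. apply lsum_ext. intros l _. rewrite lsum_scal.
    change (lsum co (fun j => tv ro Z1 (u l) j * x j)) with (dot co (tv ro Z1 (u l)) x).
    rewrite dot_tv, Rmult_comm. f_equal. apply dot_ext; intros; auto.
  - intros j _. rewrite Rmult_minus_distr_r. f_equal. unfold comb.
    rewrite Rmult_comm, <- lsum_scal. apply lsum_ext; intros; ring.
Qed.

(** The two summands act on orthogonal components of [x] (along the [w] and across them) and have
    orthogonal ranges. Pythagoras on both sides reduces the claim to each summand being a
    contraction. *)
Lemma op_le_perp {I J} (ro : list I) (co : list J) k u w Z :
  orth ro k u -> orth co k w -> op_le ro co Z 1 ->
  op_le ro co (fun i j => iso k u w i j + perp ro co k u w Z i j) 1.
Proof.
  intros Hu Hw [_ HZ]. split; [lra|]. intros x.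
  rewrite (dot_ext ro (mv co (fun i j => iso k u w i j + perp ro co k u w Z i j) x)
                      (mv co (fun i j => iso k u w i j + perp ro co k u w Z i j) x)
    (fun i => comb k (fun l => dot co (w l) x) u i + proj ro k u (mv co Z (proj co k w x)) i)
    (fun i => comb k (fun l => dot co (w l) x) u i + proj ro k u (mv co Z (proj co k w x)) i)).
  2,3: intros i _; rewrite <- mv_iso with (co := co), <- mv_perp; unfold mv;
       rewrite dot_comm, dot_plus_r, dot_comm, (dot_comm co x); reflexivity.
  rewrite dot_plus_sq by now apply dot_comb_proj.
  rewrite dot_comb_comb by auto.
  pose proof (proj_le ro k u (mv co Z (proj co k w x)) Hu).
  pose proof (HZ (proj co k w x)). rewrite (pythagoras co k w x Hw). lra.
Qed.

(* The dual certificate [iso + perp Z] makes the nuclear norm of [B] exceed that of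
   [A] by the component of the difference orthogonal to the row and column spaces. *)
Lemma nuc_diff_ge {I J} (ro : list I) (co : list J) A k sigma u w B k' sigma' u' w' Z :
  svd ro co A k sigma u w -> svd ro co B k' sigma' u' w' -> op_le ro co Z 1 ->
  ip ro co (fun i j => iso k u w i j + perp ro co k u w Z i j) (fun i j => B i j - A i j)
  <= lsum (seq 0 k') sigma' - lsum (seq 0 k) sigma.
Proof.
  intros HA HB HZ. set (Y := fun i j => iso k u w i j + perp ro co k u w Z i j).
  assert (HY : op_le ro co Y 1) by (apply op_le_perp; auto; apply HA).
  pose proof (ip_svd_le ro co B k' sigma' u' w' Y HB HY) as HBY.
  (* The certificate is tight at [A]: it sends [w l] to [u l] plus a vector orthogonal to all the
     [u]. *)
  assert (HAY : ip ro co A Y = lsum (seq 0 k) sigma).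
  { destruct HA as (Hs & Hu & Hw & HA).
    rewrite (ip_ext ro co A Y (fun i j => lsum (seq 0 k) (fun l => sigma l * (u l i * w l j))) Y);
      [|intros; rewrite HA by auto; apply lsum_ext; intros; ring|reflexivity].
    rewrite (ip_lsum_l ro co k (fun l i j => sigma l * (u l i * w l j))).
    apply lsum_ext. intros l Hl. apply in_seq in Hl. rewrite ip_scal_l, ip_outer_l.
    rewrite (dot_ext ro (u l) (mv co Y (w l)) (u l)
      (fun i => comb k (fun a => dot co (w a) (w l)) u i + proj ro k u (mv co Z (proj co k w (w l))) i)).
    - rewrite dot_plus_r, dot_comb_orth, dot_proj_orth, Hw, Nat.eqb_refl by (auto; lia). ring.
    - reflexivity.
    - intros i _; rewrite <- mv_iso with (co := co), <- mv_perp; unfold mv, Y;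
       rewrite dot_comm, dot_plus_r, dot_comm, (dot_comm co (w l)); reflexivity. }
  rewrite ip_comm in HBY, HAY.
  replace (ip ro co Y (fun i j => B i j - A i j)) with (ip ro co Y B - ip ro co Y A); [lra|].
  unfold ip. rewrite <- lsum_minus. apply lsum_ext. intros i _.
  rewrite <- lsum_minus. apply lsum_ext; intros; ring.
Qed.

Lemma le_sqrt_of_CS (X a b s : R) : 0 <= s -> 0 <= b ->
  X ^ 2 <= (s ^ 2 * a) * b -> 0 <= a -> X <= s * sqrt (a * b).
Proof.
  intros Hs Hb HX Ha. apply le_of_sq_le.
  - apply Rmult_le_pos; [auto|apply sqrt_pos].
  - rewrite Rpow_mult_distr. rewrite pow2_sqrt by nra. lra.
Qed.

(** Cauchy-Schwarz over the pairs [(l, i)]: the [u l] contribute [k] in total and the vectors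
    [D (w l)] at most the squared Frobenius norm. *)
Lemma Rabs_ip_iso_le {I J} (ro : list I) (co : list J) k u w D :
  orth ro k u -> orth co k w -> Rabs (ip ro co (iso k u w) D) <= sqrt (INR k * ip ro co D D).
Proof.
  intros Hu Hw.
  assert (E : ip ro co (iso k u w) D = lsum (seq 0 k) (fun l => dot ro (u l) (mv co D (w l)))).
  { unfold iso. rewrite (ip_lsum_l ro co k (fun l i j => u l i * w l j)).
    apply lsum_ext. intros. apply ip_outer_l. }
  assert (H : (ip ro co (iso k u w) D) ^ 2 <= (1 ^ 2 * INR k) * ip ro co D D).
  { rewrite E. unfold dot at 1. eapply Rle_trans; [apply lsum_CS2|].
    replace (lsum (seq 0 k) (fun i => lsum ro (fun j => u i j * u i j))) with (INR k).
    - pose proof (lsum_mv_sq_le ro co D k w Hw). pose proof (pos_INR k).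
      unfold dot at 1 in H. nra.
    - rewrite (lsum_ext (seq 0 k) _ (fun _ => 1)).
      + rewrite lsum_const, length_seq. ring.
      + intros l Hl. apply in_seq in Hl.
        change (dot ro (u l) (u l) = 1). rewrite Hu, Nat.eqb_refl by lia. reflexivity. }
  pose proof (ip_nonneg ro co D). pose proof (pos_INR k).
  apply Rabs_le. split.
  - assert (- ip ro co (iso k u w) D <= 1 * sqrt (INR k * ip ro co D D)); [|lra].
    apply le_sqrt_of_CS; lra.
  - rewrite <- Rmult_1_l. apply le_sqrt_of_CS; lra.
Qed.

Lemma op_le_sum {I J} (ro : list I) (co : list J) Z s k (x : nat -> J -> R) :
  op_le ro co Z s ->
  lsum (seq 0 k) (fun l => dot ro (mv co Z (x l)) (mv co Z (x l)))
  <= s ^ 2 * lsum (seq 0 k) (fun l => dot co (x l) (x l)).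
Proof. intros [_ H]. rewrite <- lsum_scal. apply lsum_le. intros; apply H. Qed.

Lemma lsum_orth {I} (l : list I) k u : orth l k u ->
  lsum (seq 0 k) (fun a => dot l (u a) (u a)) = INR k.
Proof.
  intros Hu. rewrite (lsum_ext (seq 0 k) _ (fun _ => 1)).
  - rewrite lsum_const, length_seq. ring.
  - intros a Ha. apply in_seq in Ha. rewrite Hu, Nat.eqb_refl by lia. reflexivity.
Qed.

Lemma op_le_rowproj {I J} (ro : list I) (co : list J) k w Z s :
  orth co k w -> op_le ro co Z s -> op_le ro co (rowproj co k w Z) s.
Proof.
  intros Hw [Hs HZ]. split; [exact Hs|]. intros x.
  rewrite (dot_ext ro (mv co (rowproj co k w Z) x) (mv co (rowproj co k w Z) x)
     (mv co Z (proj co k w x)) (mv co Z (proj co k w x)))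
    by (intros; unfold mv, rowproj; apply dot_proj_l).
  pose proof (HZ (proj co k w x)). pose proof (proj_le co k w x Hw).
  pose proof (pow2_ge_0 s). nra.
Qed.

(** [Z] splits as [perp Z + (Z W) W^T + U (U^T Z1)]. Each of the last two has rank at most [k], and
    pairs with [D] to at most [s * sqrt (INR k)] times the Frobenius norm of [D]. *)
Lemma ip_parallel_le {I J} (ro : list I) (co : list J) k u w Z s D :
  orth ro k u -> orth co k w -> op_le ro co Z s ->
  ip ro co Z D <= ip ro co (perp ro co k u w Z) D + 2 * (s * sqrt (INR k * ip ro co D D)).
Proof.
  intros Hu Hw HZ. pose proof (pos_INR k) as Hk. pose proof (ip_nonneg ro co D) as HD.
  assert (Hs : 0 <= s) by apply HZ.
  set (Z1 := rowproj co k w Z).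
  assert (HZ1 : op_le ro co Z1 s) by now apply op_le_rowproj.
  assert (E : ip ro co Z D = ip ro co (perp ro co k u w Z) D
    + lsum (seq 0 k) (fun l => dot ro (mv co Z (w l)) (mv co D (w l)))
    + lsum (seq 0 k) (fun l => dot ro (u l) (mv co D (tv ro Z1 (u l))))).
  { rewrite (ip_ext ro co Z D
      (fun i j => (perp ro co k u w Z i j
                   + lsum (seq 0 k) (fun l => mv co Z (w l) i * w l j))
                   + lsum (seq 0 k) (fun l => u l i * tv ro Z1 (u l) j)) D).
    - rewrite !ip_plus_l.
      rewrite (ip_lsum_l ro co k (fun l i j => mv co Z (w l) i * w l j)).
      rewrite (ip_lsum_l ro co k (fun l i j => u l i * tv ro Z1 (u l) j)).
      f_equal; [f_equal|]; apply lsum_ext; intros; apply ip_outer_l.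
    - intros i j _ _. unfold perp, proj, comb. fold Z1.
      rewrite (lsum_ext (seq 0 k) (fun l => u l i * tv ro Z1 (u l) j)
                (fun a => dot ro (u a) (fun i' => Z1 i' j) * u a i)).
      + unfold Z1 at 1. unfold rowproj, proj, comb.
        rewrite (lsum_ext (seq 0 k) (fun l => mv co Z (w l) i * w l j)
                  (fun a => dot co (w a) (Z i) * w a j)).
        * ring.
        * intros. unfold mv. now rewrite dot_comm.
      + intros. unfold tv, dot. ring.
    - reflexivity. }
  rewrite E.
  assert (H1 : lsum (seq 0 k) (fun l => dot ro (mv co Z (w l)) (mv co D (w l)))
               <= s * sqrt (INR k * ip ro co D D)).
  { apply le_sqrt_of_CS; auto. unfold dot at 1. eapply Rle_trans; [apply lsum_CS2|].
    pose proof (op_le_sum ro co Z s k w HZ) as H1. rewrite (lsum_orth co k w Hw) in H1.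
    pose proof (lsum_mv_sq_le ro co D k w Hw) as H2. unfold dot at 1 in H2.
    unfold dot at 1 in H1.
    apply Rmult_le_compat; auto;
      apply lsum_nonneg; intros; apply lsum_nonneg; intros; apply Rle_0_sqr. }
  assert (H2 : lsum (seq 0 k) (fun l => dot ro (u l) (mv co D (tv ro Z1 (u l))))
               <= s * sqrt (INR k * ip ro co D D)).
  { rewrite (lsum_ext (seq 0 k) _ (fun l => dot ro (u l) (mv co Z1 (tv ro D (u l))))).
    2:{ intros l _. rewrite <- !dot_tv. apply dot_comm. }
    apply le_sqrt_of_CS; auto. unfold dot at 1. eapply Rle_trans; [apply lsum_CS2|].
    pose proof (op_le_sum ro co Z1 s k (fun l => tv ro D (u l)) HZ1) as H2.
    pose proof (lsum_tv_sq_le ro co D k u Hu) as H3.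
    pose proof (lsum_orth ro k u Hu) as H4. unfold dot at 1 in H4. rewrite H4.
    unfold dot at 1 in H2. pose proof (pow2_ge_0 s).
    rewrite (Rmult_comm (s ^ 2)), Rmult_assoc. apply Rmult_le_compat_l; [exact Hk|].
    eapply Rle_trans; [exact H2|]. now apply Rmult_le_compat_l. }
  lra.
Qed.

Lemma perp_scal {I J} (ro : list I) (co : list J) k u w c Z i j :
  perp ro co k u w (fun i j => c * Z i j) i j = c * perp ro co k u w Z i j.
Proof.
  assert (Hp : forall {K} (l : list K) v x y, proj l k v (fun i => c * x i) y = c * proj l k v x y).
  { intros. unfold proj, comb. rewrite Rmult_minus_distr_l, <- lsum_scal. f_equal.
    apply lsum_ext. intros. rewrite dot_scal_r. ring. }
  unfold perp, rowproj. rewrite <- Hp. unfold proj at 1 3. f_equal.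
  - apply Hp.
  - unfold comb. apply lsum_ext. intros. f_equal. apply dot_ext; auto.
Qed.

Lemma op_le_scal {I J} (ro : list I) (co : list J) c Z s : 0 <= c ->
  op_le ro co Z s -> op_le ro co (fun i j => c * Z i j) (c * s).
Proof.
  intros Hc [Hs HZ]. split; [nra|]. intros x.
  assert (E : dot ro (mv co (fun i j => c * Z i j) x) (mv co (fun i j => c * Z i j) x)
    = c ^ 2 * dot ro (mv co Z x) (mv co Z x)).
  { unfold dot at 1. change (dot ro (mv co Z x) (mv co Z x))
      with (lsum ro (fun i => mv co Z x i * mv co Z x i)).
    rewrite <- lsum_scal. apply lsum_ext. intros i _.
    replace (mv co (fun i j => c * Z i j) x i) with (c * mv co Z x i); [ring|].
    unfold mv. rewrite dot_comm, <- dot_scal_r. apply dot_comm. }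
  rewrite E. pose proof (HZ x). pose proof (pow2_ge_0 c). rewrite Rpow_mult_distr.
  rewrite Rmult_assoc. apply Rmult_le_compat_l; auto.
Qed.

Lemma op_le_opp {I J} (ro : list I) (co : list J) Z s :
  op_le ro co Z s -> op_le ro co (fun i j => - Z i j) s.
Proof.
  intros [Hs HZ]. split; [exact Hs|]. intros x.
  replace (dot ro (mv co (fun i j => - Z i j) x) (mv co (fun i j => - Z i j) x))
    with (dot ro (mv co Z x) (mv co Z x)); [apply HZ|].
  apply lsum_ext. intros i _.
  replace (mv co (fun i j => - Z i j) x i) with (- mv co Z x i); [ring|].
  replace (- mv co Z x i) with ((-1) * mv co Z x i) by ring.
  unfold mv, dot. rewrite <- lsum_scal.
  apply lsum_ext; intros; ring.
Qed.

Lemma op_le_weaken {I J} (ro : list I) (co : list J) Z s t :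
  op_le ro co Z s -> s <= t -> op_le ro co Z t.
Proof.
  intros [Hs HZ] Hst. split; [lra|]. intros x.
  eapply Rle_trans; [apply HZ|]. apply Rmult_le_compat_r; [apply dot_nonneg|].
  apply pow_incr. lra.
Qed.

Lemma op_le_unit {I J} (ro : list I) (co : list J) Z s :
  0 < s -> op_le ro co Z s -> op_le ro co (fun i j => / s * Z i j) 1.
Proof.
  intros Hs HZ. apply (op_le_scal ro co (/ s)) in HZ.
  - rewrite Rinv_l in HZ by lra. exact HZ.
  - left. now apply Rinv_0_lt_compat.
Qed.

(** The factor [3] collects [2] from the parallel part of [Z] and [1] from the term [iso] of the
    certificate, which is applied to [Z / s]. *)
Lemma ip_le_nuc_diff {I J} (ro : list I) (co : list J) A k sigma u w B k' sigma' u' w' Z s :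
  svd ro co A k sigma u w -> svd ro co B k' sigma' u' w' -> 0 < s -> op_le ro co Z s ->
  let D := fun i j => B i j - A i j in
  ip ro co Z D <= s * (lsum (seq 0 k') sigma' - lsum (seq 0 k) sigma
                       + 3 * sqrt (INR k * ip ro co D D)).
Proof.
  intros HA HB Hs HZ D.
  assert (Hu : orth ro k u) by apply HA. assert (Hw : orth co k w) by apply HA.
  pose proof (ip_parallel_le ro co k u w Z s D Hu Hw HZ) as H1.
  pose proof (nuc_diff_ge ro co A k sigma u w B k' sigma' u' w' (fun i j => / s * Z i j)
               HA HB (op_le_unit ro co Z s Hs HZ)) as H2.
  fold D in H2. rewrite ip_plus_l in H2.
  rewrite (ip_ext ro co (perp ro co k u w (fun i j => / s * Z i j)) D
             (fun i j => / s * perp ro co k u w Z i j) D) in H2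
    by (intros; try apply perp_scal; reflexivity).
  rewrite ip_scal_l in H2.
  pose proof (Rabs_ip_iso_le ro co k u w D Hu Hw) as H3.
  pose proof (Rle_abs (- ip ro co (iso k u w) D)) as H4. rewrite Rabs_Ropp in H4.
  set (P := ip ro co (perp ro co k u w Z) D) in *.
  set (g := sqrt (INR k * ip ro co D D)) in *.
  assert (H5 : P = s * (/ s * P)) by (field; lra).
  assert (/ s * P <= lsum (seq 0 k') sigma' - lsum (seq 0 k) sigma + g) by lra.
  assert (s * (/ s * P) <= s * (lsum (seq 0 k') sigma' - lsum (seq 0 k) sigma + g)) by nra.
  lra.
Qed.

Lemma op_le_zero {I J} (ro : list I) (co : list J) : op_le ro co (fun _ _ => 0) 1.
Proof.
  split; [lra|]. intros x.
  assert (E : forall i, mv co (fun (_ : I) (_ : J) => 0) x i = 0).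
  { intros. transitivity (lsum co (fun _ => 0)); [|apply lsum_zero].
    apply lsum_ext; intros; ring. }
  replace (dot ro (mv co (fun _ _ => 0) x) (mv co (fun _ _ => 0) x)) with 0.
  - pose proof (dot_nonneg co x). lra.
  - transitivity (lsum ro (fun _ => 0)); [symmetry; apply lsum_zero|].
    apply lsum_ext. intros. rewrite E. ring.
Qed.

Lemma nuc_diff_lower {I J} (ro : list I) (co : list J) A k sigma u w B k' sigma' u' w' :
  svd ro co A k sigma u w -> svd ro co B k' sigma' u' w' ->
  let D := fun i j => B i j - A i j in
  lsum (seq 0 k) sigma - lsum (seq 0 k') sigma' <= sqrt (INR k * ip ro co D D).
Proof.
  intros HA HB D.
  assert (Hu : orth ro k u) by apply HA. assert (Hw : orth co k w) by apply HA.
  (* The certificate with [Z = 0], written as a product so that [perp_scal] with factor [0] removes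
     its second part. *)
  pose proof (nuc_diff_ge ro co A k sigma u w B k' sigma' u' w' (fun i j => 0 * 0)
               HA HB) as H2.
  fold D in H2. rewrite ip_plus_l in H2.
  rewrite (ip_ext ro co (perp ro co k u w (fun i j => 0 * 0)) D (fun i j => 0 * 0) D) in H2.
  - rewrite (ip_scal_l ro co 0 (fun _ _ => 0)) in H2.
    pose proof (Rabs_ip_iso_le ro co k u w D Hu Hw) as H3.
    pose proof (Rle_abs (- ip ro co (iso k u w) D)) as H4. rewrite Rabs_Ropp in H4.
    assert (op_le ro co (fun (_ : I) (_ : J) => 0 * 0) 1).
    { rewrite Rmult_0_r. apply op_le_zero. }
    specialize (H2 H). lra.
  - intros. rewrite (perp_scal ro co k u w 0 (fun _ _ => 0)). cbv beta. ring.
  - reflexivity.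
Qed.

(* The last hypothesis is the basic inequality of the penalized problem: [B] is optimal, [Z] is
   the gradient of the loss at [A] and [Q] the strong convexity term. *)
Lemma penalized_bounds {I J} (ro : list I) (co : list J) A k sigma u w B k' sigma' u' w' Z lam Q :
  svd ro co A k sigma u w -> svd ro co B k' sigma' u' w' ->
  let D := fun i j => B i j - A i j in
  let g := sqrt (INR k * ip ro co D D) in
  0 < lam -> op_le ro co Z (lam / 2) -> 0 <= Q ->
  Q + ip ro co Z D <= lam * (lsum (seq 0 k) sigma - lsum (seq 0 k') sigma') ->
  Q <= 2 * lam * g /\ nuc_le ro co D (6 * g).
Proof.
  intros HA HB D g Hlam HZ HQ Hopt.
  pose proof (ip_le_nuc_diff ro co A k sigma u w B k' sigma' u' w' _ (lam / 2) HA HB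
                ltac:(lra) (op_le_opp ro co Z (lam / 2) HZ)) as H1.
  cbv zeta in H1. fold D in H1.
  replace (ip ro co (fun i j => - Z i j) D) with (- ip ro co Z D) in H1.
  2:{ rewrite (ip_ext ro co (fun i j => - Z i j) D (fun i j => (-1) * Z i j) D)
        by (intros; ring). rewrite ip_scal_l. ring. }
  pose proof (nuc_diff_lower ro co A k sigma u w B k' sigma' u' w' HA HB) as H2.
  cbv zeta in H2. fold D in H2. fold g in H1, H2.
  set (a := lsum (seq 0 k) sigma - lsum (seq 0 k') sigma') in *.
  assert (H3 : lsum (seq 0 k') sigma' - lsum (seq 0 k) sigma = - a) by (unfold a; ring).
  rewrite H3 in H1.
  (* The basic inequality and [H1] add up to [Q <= lam / 2 * (a + 3 * g)]. Since [Q >= 0], this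
     bounds [- a]; with [a <= g] it gives [Q <= 2 * lam * g]. *)
  assert (Hga : - a <= 3 * g).
  { apply Rmult_le_reg_l with (lam / 2); lra. }
  split.
  - assert (lam / 2 * a <= lam / 2 * g) by (apply Rmult_le_compat_l; lra). lra.
  - assert (Hpos : forall Y s, 0 < s -> op_le ro co Y s -> ip ro co Y D <= s * (6 * g)).
    { intros Y s Hs HY.
      pose proof (ip_le_nuc_diff ro co A k sigma u w B k' sigma' u' w' Y s HA HB Hs HY) as H4.
      cbv zeta in H4. fold D in H4. fold g in H4. rewrite H3 in H4.
      eapply Rle_trans; [exact H4|]. apply Rmult_le_compat_l; lra. }
    intros Y s HY. apply Rnot_lt_le. intros Hlt.
    assert (Hg : 0 <= g) by apply sqrt_pos.
    (* The bound just proved asks for a positive [s], so [s] is raised by [e]. This [e] is small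
       enough that the bound grows by less than the assumed excess. *)
    set (e := (ip ro co Y D - s * (6 * g)) / (6 * g + 1)).
    assert (He : 0 < e) by (unfold e; apply Rdiv_lt_0_compat; lra).
    assert (Hs : 0 <= s) by apply HY.
    pose proof (Hpos Y (s + e) ltac:(lra) (op_le_weaken ro co Y s (s + e) HY ltac:(lra))) as H5.
    assert (e * (6 * g + 1) = ip ro co Y D - s * (6 * g)) by (unfold e; field; lra).
    nra.
Qed.

(** * Concentration for Lipschitz functions of independent Bernoulli variables *)

Definition entry {T} (A : nat -> nat -> nat -> T) (t : nat * nat * nat) : T :=
  let '(v, i, j) := t in A v i j.

Definition cset (c : cfg) (t : nat * nat * nat) (b : bool) : cfg :=
  let '(v, i, j) := t in upd c v i j b.

Definition prob_on (l : list (nat * nat * nat)) (q : cmat) : Prop :=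
  forall t, In t l -> 0 <= entry q t <= 1.

(** Exactly the configurations at which [Eprod l] evaluates its argument. Their finiteness later
    turns a supremum into a finite maximum. *)
Fixpoint configs (l : list (nat * nat * nat)) : list cfg :=
  match l with
  | nil => [fun _ _ _ => false]
  | t :: l' => map (fun c => cset c t true) (configs l') ++ map (fun c => cset c t false) (configs l')
  end.

Lemma entry_cset_same c t b : entry (cset c t b) t = b.
Proof. destruct t as [[v i] j]. simpl. unfold upd. now rewrite !Nat.eqb_refl. Qed.

Lemma entry_cset_other c t t' b : t <> t' -> entry (cset c t b) t' = entry c t'.
Proof.
  destruct t as [[v i] j], t' as [[v' i'] j']. intros H. simpl. unfold upd.
  destruct (Nat.eqb_spec v v'); simpl; [|reflexivity].
  destruct (Nat.eqb_spec i i'); simpl; [|reflexivity].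
  destruct (Nat.eqb_spec j j'); simpl; [|reflexivity].
  subst. congruence.
Qed.

Lemma Eprod_cons t l q F : Eprod (t :: l) q F =
  entry q t * Eprod l q (fun c => F (cset c t true))
  + (1 - entry q t) * Eprod l q (fun c => F (cset c t false)).
Proof. now destruct t as [[v i] j]. Qed.

Lemma prob_on_cons t l q : prob_on (t :: l) q -> 0 <= entry q t <= 1 /\ prob_on l q.
Proof. intros H. split; [apply H; now left|]. intros t' Ht'. apply H. now right. Qed.

Lemma Eprod_le_in l q F G : prob_on l q ->
  (forall c, In c (configs l) -> F c <= G c) -> Eprod l q F <= Eprod l q G.
Proof.
  revert F G. induction l as [|t l IH]; intros F G Hq H; [apply H; now left|].
  apply prob_on_cons in Hq as [Ht Hq]. rewrite !Eprod_cons.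
  apply Rplus_le_compat; (apply Rmult_le_compat_l; [lra|]); apply IH; auto;
    intros c Hc; apply H; simpl; apply in_app_iff; [left|right];
    apply in_map_iff; now exists c.
Qed.

Lemma Eprod_le l q F G : prob_on l q -> (forall c, F c <= G c) -> Eprod l q F <= Eprod l q G.
Proof. intros Hq H. now apply Eprod_le_in. Qed.

Lemma Eprod_ext l q F G : (forall c, F c = G c) -> Eprod l q F = Eprod l q G.
Proof.
  revert F G. induction l as [|t l IH]; intros F G H; [apply H|].
  rewrite !Eprod_cons. f_equal; f_equal; apply IH; auto.
Qed.

Lemma Eprod_lin l q a b F G :
  Eprod l q (fun c => a * F c + b * G c) = a * Eprod l q F + b * Eprod l q G.
Proof.
  revert F G. induction l as [|t l IH]; intros F G; [reflexivity|].
  rewrite !Eprod_cons, !IH. ring.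
Qed.

Lemma Eprod_const l q a : Eprod l q (fun _ => a) = a.
Proof. induction l as [|t l IH]; [reflexivity|]. rewrite Eprod_cons, IH. ring. Qed.

Lemma Eprod_scal l q a F : Eprod l q (fun c => a * F c) = a * Eprod l q F.
Proof.
  rewrite (Eprod_ext l q _ (fun c => a * F c + 0 * F c)) by (intros; ring).
  rewrite Eprod_lin. ring.
Qed.

Lemma Eprod_affine l q a b F : Eprod l q (fun c => a + b * F c) = a + b * Eprod l q F.
Proof.
  rewrite (Eprod_ext l q _ (fun c => 1 * a + b * F c)) by (intros; ring).
  rewrite (Eprod_lin l q 1 b (fun _ => a)), Eprod_const. ring.
Qed.

Lemma exp_le_inv y : y < 1 -> exp y <= / (1 - y).
Proof.
  intros H. pose proof (exp_ineq1_le (- y)) as H1. rewrite exp_Ropp in H1.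
  rewrite <- (Rinv_inv (exp y)). apply Rinv_le_contravar; lra.
Qed.

Lemma exp_convex th a b : 0 <= th <= 1 ->
  exp ((1 - th) * a + th * b) <= (1 - th) * exp a + th * exp b.
Proof.
  intros Hth. set (m := (1 - th) * a + th * b).
  assert (H : forall x, exp m * (1 + (x - m)) <= exp x).
  { intros x. replace (exp x) with (exp m * exp (x - m)) by (rewrite <- exp_plus; f_equal; ring).
    apply Rmult_le_compat_l; [left; apply exp_pos|apply exp_ineq1_le]. }
  replace (exp m) with ((1 - th) * (exp m * (1 + (a - m))) + th * (exp m * (1 + (b - m))))
    by (unfold m; ring).
  apply Rplus_le_compat; apply Rmult_le_compat_l; auto; lra.
Qed.

(** Hölder's inequality in exponential form: after normalization by [exp al] and [exp be] it is the
    pointwise convexity of [exp]. *)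
Lemma Eprod_exp_mix l q th A B al be : prob_on l q -> 0 <= th <= 1 ->
  Eprod l q (fun c => exp (A c)) <= exp al -> Eprod l q (fun c => exp (B c)) <= exp be ->
  Eprod l q (fun c => exp ((1 - th) * A c + th * B c)) <= exp ((1 - th) * al + th * be).
Proof.
  intros Hq Hth HA HB. set (m := exp ((1 - th) * al + th * be)).
  assert (Hm : 0 < m) by apply exp_pos.
  apply Rle_trans with (Eprod l q (fun c =>
     (m * (1 - th) * exp (- al)) * exp (A c) + (m * th * exp (- be)) * exp (B c))).
  - apply Eprod_le; [exact Hq|]. intros c.
    replace (exp ((1 - th) * A c + th * B c))
      with (m * exp ((1 - th) * (A c - al) + th * (B c - be)))
      by (unfold m; rewrite <- exp_plus; f_equal; ring).
    pose proof (exp_convex th (A c - al) (B c - be) Hth) as H.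
    replace (exp (A c - al)) with (exp (A c) * exp (- al)) in H by (now rewrite <- exp_plus).
    replace (exp (B c - be)) with (exp (B c) * exp (- be)) in H by (now rewrite <- exp_plus).
    eapply Rle_trans; [apply Rmult_le_compat_l; [lra|exact H]|]. right; ring.
  - rewrite Eprod_lin.
    assert (Ha : exp (- al) * Eprod l q (fun c => exp (A c)) <= 1).
    { rewrite exp_Ropp. apply Rmult_le_reg_l with (exp al); [apply exp_pos|].
      rewrite <- Rmult_assoc, Rinv_r by apply Rgt_not_eq, exp_pos. lra. }
    assert (Hb : exp (- be) * Eprod l q (fun c => exp (B c)) <= 1).
    { rewrite exp_Ropp. apply Rmult_le_reg_l with (exp be); [apply exp_pos|].
      rewrite <- Rmult_assoc, Rinv_r by apply Rgt_not_eq, exp_pos. lra. }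
    set (x := exp (- al) * _) in Ha. set (y := exp (- be) * _) in Hb.
    replace (m * (1 - th) * exp (- al) * Eprod l q (fun c => exp (A c))
             + m * th * exp (- be) * Eprod l q (fun c => exp (B c)))
      with (m * ((1 - th) * x + th * y)) by (unfold x, y; ring).
    rewrite <- (Rmult_1_r m) at 2. apply Rmult_le_compat_l; [lra|]. nra.
Qed.

(* [mixmin A B] is the minimum over [0 <= th <= 1] of [(1 - th) * A + th * B + th ^ 2 / 8]. *)
Definition mixmin (A B : R) : R :=
  if Rle_dec A B then A
  else if Rle_dec (A - B) (/ 4) then A - 2 * (A - B) ^ 2 else B + / 8.

Lemma mixmin_le A B th : 0 <= th <= 1 -> mixmin A B <= (1 - th) * A + th * B + th ^ 2 / 8.
Proof.
  intros Hth. unfold mixmin. destruct Rle_dec; [nra|]. destruct Rle_dec.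
  - pose proof (pow2_ge_0 (th - 4 * (A - B))). lra.
  - assert (0 <= (1 - th) * ((A - B) - (1 + th) / 8)) by (apply Rmult_le_pos; lra). lra.
Qed.

(** The mixture with weight [th] is at least [C - th * a + th ^ 2 / 8], whose minimum over all real
    [th], at [4 * a], is [C - 2 * a ^ 2]. *)
Lemma mixmin_ge A B C a : 0 <= a -> C <= A -> C - a <= B -> C - 2 * a ^ 2 <= mixmin A B.
Proof.
  intros Ha HA HB. unfold mixmin. destruct Rle_dec; [nra|]. destruct Rle_dec.
  - destruct (Rle_dec (A - B) a) as [H|H]; [nra|].
    assert (0 <= (A - B - a) * (/ 2 - (A - B) - a)) by (apply Rmult_le_pos; lra). nra.
  - pose proof (pow2_ge_0 (a - / 4)). lra.
Qed.

Lemma exp_le x y : x <= y -> exp x <= exp y.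
Proof.
  intros [H|H]; [left; now apply exp_increasing|right; now rewrite H].
Qed.

(* Infimum-convolution on the discrete cube, computed one coordinate at a time: it
   dominates the infimum of [E_nu f + sum_t P_nu(y_t <> x_t)^2 / 8] over laws [nu] of [y]. *)
Fixpoint infconv (l : list (nat * nat * nat)) (f : cfg -> R) (x : cfg) : R :=
  match l with
  | nil => f (fun _ _ _ => false)
  | t :: l' => mixmin (infconv l' (fun c => f (cset c t (entry x t))) x)
                      (infconv l' (fun c => f (cset c t (negb (entry x t)))) x)
  end.

Lemma infconv_ext l f x x' : (forall t, In t l -> entry x t = entry x' t) ->
  infconv l f x = infconv l f x'.
Proof.
  revert f. induction l as [|t l IH]; intros f H; [reflexivity|].
  simpl. rewrite (H t (or_introl eq_refl)). f_equal; apply IH; intros; apply H; now right.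
Qed.

Definition differ (x y : cfg) (t : nat * nat * nat) : R :=
  if Bool.eqb (entry x t) (entry y t) then 0 else 1.

(** Each coordinate costs [2 * a t ^ 2] through [mixmin_ge]: keeping the value of [x] at [t]
    preserves the lower bound, flipping it loses [a t]. *)
Lemma infconv_ge l f x C a : NoDup l -> (forall t, 0 <= a t) ->
  (forall y, C - lsum l (fun t => a t * differ x y t) <= f y) ->
  C - 2 * lsum l (fun t => a t ^ 2) <= infconv l f x.
Proof.
  intros Hnd Ha. revert f C Hnd. induction l as [|t l IH]; intros f C Hnd H.
  - specialize (H (fun _ _ _ => false)). simpl in *. lra.
  - cbn [infconv]. rewrite lsum_cons. inversion Hnd as [|? ? Hni Hnd']; subst.
    assert (Hrest : forall y b, lsum l (fun t' => a t' * differ x (cset y t b) t')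
                     = lsum l (fun t' => a t' * differ x y t')).
    { intros y b. apply lsum_ext. intros t' Ht'. unfold differ.
      rewrite entry_cset_other; [reflexivity|]. intros ->. contradiction. }
    replace (C - 2 * (a t ^ 2 + lsum l (fun t => a t ^ 2)))
      with (C - 2 * lsum l (fun t => a t ^ 2) - 2 * a t ^ 2) by ring.
    apply mixmin_ge; [apply Ha| |].
    + apply IH; auto. intros y. specialize (H (cset y t (entry x t))).
      rewrite lsum_cons, Hrest in H. unfold differ at 1 in H.
      rewrite entry_cset_same, Bool.eqb_reflx in H. cbv iota in H. lra.
    + replace (C - 2 * lsum l (fun t0 => a t0 ^ 2) - a t)
        with ((C - a t) - 2 * lsum l (fun t0 => a t0 ^ 2)) by ring.
      apply IH; auto. intros y. specialize (H (cset y t (negb (entry x t)))).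
      rewrite lsum_cons, Hrest in H. unfold differ at 1 in H.
      rewrite entry_cset_same, Bool.eqb_negb2 in H. cbv iota in H. lra.
Qed.

(** For [L <= / 4] the exponent is minimal at [th = 4 * L], and [exp y <= / (1 - y)] reduces the
    claim to [0 <= L ^ 3]. For larger [L], [th = 1] leaves [8 / 7 + 4 / 5 < 2]. *)
Lemma exp_mix_bound L : 0 <= L ->
  exists th, 0 <= th <= 1 /\ exp (th ^ 2 / 8 + (1 - th) * L) + exp (- L) <= 2.
Proof.
  intros HL.
  assert (H1 : exp (- L) <= / (1 + L)).
  { replace (1 + L) with (1 - - L) by ring. apply exp_le_inv. lra. }
  destruct (Rle_dec L (/ 4)) as [H|H].
  - exists (4 * L). split; [lra|].
    replace ((4 * L) ^ 2 / 8 + (1 - 4 * L) * L) with (L - 2 * L ^ 2) by field.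
    assert (H2 : exp (L - 2 * L ^ 2) <= / (1 - (L - 2 * L ^ 2))) by (apply exp_le_inv; nra).
    assert (H3 : / (1 - (L - 2 * L ^ 2)) + / (1 + L) <= 2); [|lra].
    assert (0 < 1 - (L - 2 * L ^ 2)) by nra.
    replace (/ (1 - (L - 2 * L ^ 2)) + / (1 + L))
      with ((2 + 2 * L ^ 2) / ((1 - (L - 2 * L ^ 2)) * (1 + L))) by (field; lra).
    apply Rmult_le_reg_r with ((1 - (L - 2 * L ^ 2)) * (1 + L)); [nra|].
    unfold Rdiv. rewrite Rmult_assoc, Rinv_l by nra.
    assert (0 <= L * L * L) by (apply Rmult_le_pos; nra). nra.
  - exists 1. split; [lra|].
    replace (1 ^ 2 / 8 + (1 - 1) * L) with (/ 8) by field.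
    assert (H2 : exp (/ 8) <= / (1 - / 8)) by (apply exp_le_inv; lra).
    assert (/ (1 + L) <= / (1 + / 4)) by (apply Rinv_le_contravar; lra).
    replace (/ (1 - / 8)) with (8 / 7) in H2 by field.
    replace (/ (1 + / 4)) with (4 / 5) in H0 by field. lra.
Qed.

(** Put [r = exp (al0 - al1)]. Optimizing over [th] gives [V1 <= exp al0 * (2 - r)], so the product
    is at most [(1 + p * (1 - r)) * (1 - p * (1 - r))], a difference of squares below [1]. *)
Lemma two_point_bound p al0 al1 V0 V1 : 0 <= p <= 1 -> al0 <= al1 ->
  V0 <= exp al0 ->
  (forall th, 0 <= th <= 1 -> V1 <= exp (th ^ 2 / 8 + (1 - th) * al1 + th * al0)) ->
  (p * V1 + (1 - p) * V0) * (p * exp (- al1) + (1 - p) * exp (- al0)) <= 1.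
Proof.
  intros Hp Hle HV0 HV1.
  destruct (exp_mix_bound (al1 - al0)) as (th & Hth & HL); [lra|].
  specialize (HV1 th Hth).
  replace (th ^ 2 / 8 + (1 - th) * al1 + th * al0)
    with (al0 + (th ^ 2 / 8 + (1 - th) * (al1 - al0))) in HV1 by ring.
  rewrite exp_plus in HV1.
  replace (exp (- al1)) with (exp (- al0) * exp (- (al1 - al0)))
    by (rewrite <- exp_plus; f_equal; ring).
  rewrite exp_Ropp with (x := al0).
  set (r := exp (- (al1 - al0))) in *. set (e := exp al0) in *.
  set (m := exp (th ^ 2 / 8 + (1 - th) * (al1 - al0))) in *.
  assert (He : 0 < e) by apply exp_pos. assert (Hr : 0 < r) by apply exp_pos.
  assert (HV1' : V1 <= e * (2 - r)).
  { eapply Rle_trans; [exact HV1|]. apply Rmult_le_compat_l; lra. }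
  apply Rle_trans with ((e * (1 + p * (1 - r))) * (p * (/ e * r) + (1 - p) * / e)).
  - apply Rmult_le_compat_r.
    + assert (0 < / e) by now apply Rinv_0_lt_compat.
      assert (0 < / e * r) by now apply Rmult_lt_0_compat.
      apply Rplus_le_le_0_compat; apply Rmult_le_pos; lra.
    + assert (p * V1 <= p * (e * (2 - r))) by (apply Rmult_le_compat_l; lra).
      assert ((1 - p) * V0 <= (1 - p) * e) by (apply Rmult_le_compat_l; lra). lra.
  - replace (e * (1 + p * (1 - r)) * (p * (/ e * r) + (1 - p) * / e))
      with (1 - (p * (1 - r)) ^ 2) by (field; lra).
    pose proof (pow2_ge_0 (p * (1 - r))). lra.
Qed.

Lemma Eprod_exp_pos l q f : prob_on l q -> 0 < Eprod l q (fun c => exp (f c)).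
Proof.
  revert f. induction l as [|t l IH]; intros f Hq; [apply exp_pos|].
  apply prob_on_cons in Hq as [Ht Hq]. rewrite Eprod_cons.
  pose proof (IH (fun c => f (cset c t true)) Hq).
  pose proof (IH (fun c => f (cset c t false)) Hq). cbv beta in *. nra.
Qed.

(* Maurey's property (tau), by tensorization. *)
Lemma infconv_exp_le l q f : NoDup l -> prob_on l q ->
  Eprod l q (fun c => exp (infconv l f c)) * Eprod l q (fun c => exp (- f c)) <= 1.
Proof.
  revert f. induction l as [|t l IH]; intros f Hnd Hq.
  { simpl. rewrite <- exp_plus, Rplus_opp_r, exp_0. lra. }
  inversion Hnd as [|? ? Hni Hnd']; subst.
  apply prob_on_cons in Hq as [Ht Hq]. rewrite !Eprod_cons.
  set (g := fun b c => f (cset c t b)).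
  set (U := fun b => Eprod l q (fun c => exp (infconv l (g b) c))).
  set (A := fun b => Eprod l q (fun c => exp (- g b c))).
  set (V := fun b => Eprod l q (fun c => exp (infconv (t :: l) f (cset c t b)))).
  change ((entry q t * V true + (1 - entry q t) * V false)
          * (entry q t * A true + (1 - entry q t) * A false) <= 1).
  assert (HA : forall b, 0 < A b) by (intros; now apply Eprod_exp_pos).
  (* With these logarithms the induction hypothesis becomes an upper bound by [exp (al b)]. *)
  pose (al := fun b => - ln (A b)).
  assert (Hal : forall b, exp (- al b) = A b).
  { intros. unfold al. rewrite Ropp_involutive. now apply exp_ln. }
  assert (HU : forall b, U b <= exp (al b)).
  { intros b. unfold al. rewrite exp_Ropp, exp_ln by auto.
    apply Rmult_le_reg_r with (A b); auto. rewrite Rinv_l by (apply Rgt_not_eq, HA).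
    apply IH; auto. }
  (* For a fixed [th], [mixmin_le] replaces the minimum by a mixture and Hölder separates its two
     branches. *)
  assert (HV : forall b th, 0 <= th <= 1 ->
     V b <= exp (th ^ 2 / 8 + (1 - th) * al b + th * al (negb b))).
  { intros b th Hth.
    apply Rle_trans with (exp (th ^ 2 / 8) *
       Eprod l q (fun c => exp ((1 - th) * infconv l (g b) c + th * infconv l (g (negb b)) c))).
    - rewrite <- Eprod_scal. apply Eprod_le; auto. intros c. rewrite <- exp_plus.
      apply exp_le. simpl. rewrite entry_cset_same.
      rewrite !(infconv_ext l _ (cset c t b) c)
        by (intros t' Ht'; apply entry_cset_other; intros ->; contradiction).
      pose proof (mixmin_le (infconv l (g b) c) (infconv l (g (negb b)) c) th Hth).
      unfold g in *. simpl in *. lra.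
    - rewrite Rplus_assoc, exp_plus. apply Rmult_le_compat_l; [left; apply exp_pos|].
      apply Eprod_exp_mix; auto; apply HU. }
  assert (HV' : forall b, V b <= exp (al b)).
  { intros b. specialize (HV b 0 ltac:(lra)).
    replace (0 ^ 2 / 8 + (1 - 0) * al b + 0 * al (negb b)) with (al b) in HV by field. exact HV. }
  (* Only the branch with the larger [al] gains from mixing with the other; the other branch takes
     [th = 0], as in [HV']. *)
  destruct (Rle_dec (al false) (al true)) as [Hle|Hle].
  - rewrite <- !Hal. apply two_point_bound; auto.
  - rewrite <- !Hal.
    pose proof (two_point_bound (1 - entry q t) (al true) (al false) (V true) (V false)
      ltac:(lra) ltac:(lra) (HV' true) (HV false)) as H. lra.
Qed.

(** Jensen's inequality, from the tangent to [exp] at the mean. *)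
Lemma exp_Eprod_le l q f : prob_on l q ->
  exp (Eprod l q f) <= Eprod l q (fun c => exp (f c)).
Proof.
  intros Hq. set (m := Eprod l q f).
  apply Rle_trans with (Eprod l q (fun c => exp m * (1 - m) + exp m * f c)).
  - rewrite Eprod_affine. fold m. right; ring.
  - apply Eprod_le; auto. intros c.
    replace (exp (f c)) with (exp m * exp (f c - m)) by (rewrite <- exp_plus; f_equal; ring).
    rewrite <- Rmult_plus_distr_l. apply Rmult_le_compat_l; [left; apply exp_pos|].
    pose proof (exp_ineq1_le (f c - m)). lra.
Qed.

(** Property (tau) for [s * F]: the infimum-convolution is at least [s * F - 2 * s ^ 2 * V], and
    Jensen bounds the second factor below. The coefficients [a] are chosen after [x], so [V] bounds
    the sum of squares at each point separately. *)
Lemma lipschitz_exp_moment l q F V s : NoDup l -> prob_on l q -> 0 <= s ->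
  (forall x, exists a, (forall t, 0 <= a t) /\ lsum l (fun t => a t ^ 2) <= V /\
     forall y, F x - lsum l (fun t => a t * differ x y t) <= F y) ->
  Eprod l q (fun c => exp (s * F c)) <= exp (s * Eprod l q F + 2 * s ^ 2 * V).
Proof.
  intros Hnd Hq Hs HF.
  pose proof (infconv_exp_le l q (fun c => s * F c) Hnd Hq) as H.
  assert (H1 : exp (- (2 * s ^ 2 * V)) * Eprod l q (fun c => exp (s * F c))
               <= Eprod l q (fun c => exp (infconv l (fun c => s * F c) c))).
  { rewrite <- Eprod_scal. apply Eprod_le; auto. intros x. rewrite <- exp_plus.
    apply exp_le. destruct (HF x) as (a & Ha & HaV & Hay).
    pose proof (infconv_ge l (fun c => s * F c) x (s * F x) (fun t => s * a t) Hnd) as H1.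
    cbv beta in H1. rewrite (lsum_ext l (fun t => (s * a t) ^ 2) (fun t => s ^ 2 * a t ^ 2)) in H1
      by (intros; ring). rewrite lsum_scal in H1.
    assert (s ^ 2 * lsum l (fun t => a t ^ 2) <= s ^ 2 * V)
      by (apply Rmult_le_compat_l; [apply pow2_ge_0|auto]).
    assert (s * F x - 2 * (s ^ 2 * lsum l (fun t => a t ^ 2)) <= infconv l (fun c => s * F c) x); [|lra].
    apply H1.
    - intros. now apply Rmult_le_pos.
    - intros y. rewrite (lsum_ext l _ (fun t => s * (a t * differ x y t))) by (intros; ring).
      rewrite lsum_scal, <- Rmult_minus_distr_l. now apply Rmult_le_compat_l. }
  assert (H2 : exp (- (s * Eprod l q F)) <= Eprod l q (fun c => exp (- (s * F c)))).
  { replace (- (s * Eprod l q F)) with (Eprod l q (fun c => - (s * F c))).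
    - now apply exp_Eprod_le.
    - rewrite (Eprod_ext l q _ (fun c => (- s) * F c)) by (intros; ring).
      rewrite Eprod_scal. ring. }
  set (X := Eprod l q (fun c => exp (s * F c))) in *.
  assert (HX : 0 < X) by now apply Eprod_exp_pos.
  assert (H3 : exp (- (2 * s ^ 2 * V)) * X * exp (- (s * Eprod l q F)) <= 1).
  { eapply Rle_trans; [|exact H]. apply Rmult_le_compat; auto.
    - apply Rmult_le_pos; [left; apply exp_pos|lra].
    - left; apply exp_pos. }
  set (w := s * Eprod l q F + 2 * s ^ 2 * V).
  replace (exp (- (2 * s ^ 2 * V)) * X * exp (- (s * Eprod l q F))) with (exp (- w) * X) in H3.
  - rewrite exp_Ropp in H3. apply Rmult_le_reg_l with (/ exp w).
    + apply Rinv_0_lt_compat, exp_pos.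
    + rewrite Rinv_l by apply Rgt_not_eq, exp_pos. exact H3.
  - transitivity (exp (- (2 * s ^ 2 * V)) * exp (- (s * Eprod l q F)) * X); [|ring].
    rewrite <- exp_plus. f_equal. f_equal. unfold w. ring.
Qed.

(** * Symmetrization and contraction *)

Definition lmax {A : Type} (a : A) (l : list A) (f : A -> R) : R :=
  fold_right (fun w m => Rmax (f w) m) (f a) l.

Lemma lmax_ge {A} (a : A) l f w : In w (a :: l) -> f w <= lmax a l f.
Proof.
  induction l as [|b l IH]; simpl; intros H.
  - destruct H as [->|[]]; lra.
  - destruct H as [H|[->|H]].
    + eapply Rle_trans; [|apply Rmax_r]. apply IH. now left.
    + apply Rmax_l.
    + eapply Rle_trans; [|apply Rmax_r]. apply IH. now right.
Qed.

Lemma lmax_attained {A} (a : A) l f : exists w, In w (a :: l) /\ lmax a l f = f w.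
Proof.
  induction l as [|b l IH]; simpl.
  - exists a; auto.
  - destruct IH as (w & Hw & E). unfold Rmax. destruct Rle_dec.
    + exists w. split; [simpl in Hw; tauto|exact E].
    + exists b; auto.
Qed.

Lemma lmax_le {A} (a : A) l f m : (forall w, In w (a :: l) -> f w <= m) -> lmax a l f <= m.
Proof. intros H. destruct (lmax_attained a l f) as (w & Hw & ->). auto. Qed.

Lemma lmax_ext {A} (a : A) l f g : (forall w, f w = g w) -> lmax a l f = lmax a l g.
Proof. intros H. unfold lmax. induction l as [|b l IH]; simpl; [apply H|]. now rewrite H, IH. Qed.

(* In the convex order the centred variable [p - B] is dominated by [2 eps B], and
   [a^2 - b^2 <= 2 |a - b|] on [-1, 1] turns the coefficient [2 a^2] into [4 a]. *)
Lemma sym_contract_step {A} (a0 : A) ls (H a : A -> R) p :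
  0 <= p <= 1 -> (forall w, In w (a0 :: ls) -> Rabs (a w) <= 1) ->
  p * lmax a0 ls (fun w => H w + (p - 1) * a w ^ 2)
  + (1 - p) * lmax a0 ls (fun w => H w + (p - 0) * a w ^ 2)
  <= (1 - p) * lmax a0 ls H
     + p * (/ 2 * lmax a0 ls (fun w => H w + 4 * a w)
            + (1 - / 2) * lmax a0 ls (fun w => H w - 4 * a w)).
Proof.
  intros Hp Ha.
  set (M0 := lmax a0 ls H).
  set (M2 := lmax a0 ls (fun w => H w + 2 * a w ^ 2)).
  set (N2 := lmax a0 ls (fun w => H w - 2 * a w ^ 2)).
  set (M4 := lmax a0 ls (fun w => H w + 4 * a w)).
  set (N4 := lmax a0 ls (fun w => H w - 4 * a w)).
  assert (H0 : forall w, In w (a0 :: ls) -> H w <= M0) by (intros; now apply lmax_ge).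
  assert (H2 : forall w, In w (a0 :: ls) -> H w + 2 * a w ^ 2 <= M2)
    by (intros w Hw; exact (lmax_ge a0 ls (fun w => H w + 2 * a w ^ 2) w Hw)).
  assert (G2 : forall w, In w (a0 :: ls) -> H w - 2 * a w ^ 2 <= N2)
    by (intros w Hw; exact (lmax_ge a0 ls (fun w => H w - 2 * a w ^ 2) w Hw)).
  assert (H4 : forall w, In w (a0 :: ls) -> H w + 4 * a w <= M4)
    by (intros w Hw; exact (lmax_ge a0 ls (fun w => H w + 4 * a w) w Hw)).
  assert (G4 : forall w, In w (a0 :: ls) -> H w - 4 * a w <= N4)
    by (intros w Hw; exact (lmax_ge a0 ls (fun w => H w - 4 * a w) w Hw)).
  (* In [E1] and [E2] the objective is a convex combination of [H] and [H - 2 a^2], respectively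
     [H + 2 a^2]. After averaging, [M0] has weight [1 - p + p ^ 2]; [E3] absorbs the surplus
     [p ^ 2 * M0]. *)
  assert (E1 : lmax a0 ls (fun w => H w + (p - 1) * a w ^ 2) <= (1 + p) / 2 * M0 + (1 - p) / 2 * N2).
  { apply lmax_le. intros w Hw. specialize (H0 w Hw). specialize (G2 w Hw). nra. }
  assert (E2 : lmax a0 ls (fun w => H w + (p - 0) * a w ^ 2) <= (1 - p / 2) * M0 + p / 2 * M2).
  { apply lmax_le. intros w Hw. specialize (H0 w Hw). specialize (H2 w Hw). nra. }
  assert (E3 : 2 * M0 <= M2 + N2).
  { assert (M0 <= (M2 + N2) / 2); [|lra]. apply lmax_le. intros w Hw.
    specialize (H2 w Hw). specialize (G2 w Hw). lra. }
  (* The maximizers [w], [w'] of the left side are used as candidates on the right, in the order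
     given by the sign of [a w - a w']. *)
  assert (E4 : M2 + N2 <= M4 + N4).
  { destruct (lmax_attained a0 ls (fun w => H w + 2 * a w ^ 2)) as (w & Hw & Ew).
    destruct (lmax_attained a0 ls (fun w => H w - 2 * a w ^ 2)) as (w' & Hw' & Ew').
    fold M2 in Ew. fold N2 in Ew'. cbv beta in *. rewrite Ew, Ew'.
    assert (Hsq : a w ^ 2 - a w' ^ 2 <= 2 * Rabs (a w - a w')).
    { replace (a w ^ 2 - a w' ^ 2) with ((a w + a w') * (a w - a w')) by ring.
      eapply Rle_trans; [apply Rle_abs|]. rewrite Rabs_mult.
      apply Rmult_le_compat_r; [apply Rabs_pos|].
      eapply Rle_trans; [apply Rabs_triang|].
      pose proof (Ha w Hw). pose proof (Ha w' Hw'). lra. }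
    pose proof (H4 w Hw). pose proof (G4 w' Hw').
    pose proof (H4 w' Hw'). pose proof (G4 w Hw).
    unfold Rabs in Hsq. destruct Rcase_abs; lra. }
  assert (E5 : p * lmax a0 ls (fun w => H w + (p - 1) * a w ^ 2)
               <= p * ((1 + p) / 2 * M0 + (1 - p) / 2 * N2)) by (apply Rmult_le_compat_l; lra).
  assert (E6 : (1 - p) * lmax a0 ls (fun w => H w + (p - 0) * a w ^ 2)
               <= (1 - p) * ((1 - p / 2) * M0 + p / 2 * M2)) by (apply Rmult_le_compat_l; lra).
  assert (E7 : p ^ 2 * (2 * M0) <= p ^ 2 * (M2 + N2)) by (apply Rmult_le_compat_l; [apply pow2_ge_0|lra]).
  assert (E8 : p * (M2 + N2) <= p * (M4 + N4)) by (apply Rmult_le_compat_l; lra).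
  lra.
Qed.

Lemma lsum_cset l t c b (phi : nat * nat * nat -> bool -> R) : ~ In t l ->
  lsum l (fun t' => phi t' (entry (cset c t b) t')) = lsum l (fun t' => phi t' (entry c t')).
Proof.
  intros H. apply lsum_ext. intros t' Ht'. rewrite entry_cset_other; [reflexivity|].
  intros ->. contradiction.
Qed.

Lemma entry_const (x : R) t : entry (fun _ _ _ => x) t = x.
Proof. now destruct t as [[v i] j]. Qed.

Definition half : cmat := fun _ _ _ => / 2.

(** [sym_contract_step] treats one coordinate conditionally on the others. The free function [h]
    absorbs the sign term [4 * W w t] or its opposite, so the induction hypothesis applies to the
    shifted problem. *)
Lemma symmetrization_contraction {A} (a0 : A) ls (W : A -> nat * nat * nat -> R) l q h :
  NoDup l -> prob_on l q ->
  (forall w t, In w (a0 :: ls) -> In t l -> Rabs (W w t) <= 1) ->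
  Eprod l q (fun b => lmax a0 ls (fun w => h w
      + lsum l (fun t => (entry q t - b2R (entry b t)) * W w t ^ 2)))
  <= Eprod l q (fun b => Eprod l half (fun e => lmax a0 ls (fun w => h w
      + lsum l (fun t => 4 * (sgn (entry e t) * b2R (entry b t)) * W w t)))).
Proof.
  intros Hnd. revert h. induction l as [|t l IH]; intros h Hq HW; [simpl; lra|].
  inversion Hnd as [|? ? Hni Hnd']; subst. specialize (IH Hnd').
  apply prob_on_cons in Hq as [Ht Hq].
  assert (IH' : forall h, Eprod l q (fun b => lmax a0 ls (fun w => h w
      + lsum l (fun t => (entry q t - b2R (entry b t)) * W w t ^ 2)))
    <= Eprod l q (fun b => Eprod l half (fun e => lmax a0 ls (fun w => h w
      + lsum l (fun t => 4 * (sgn (entry e t) * b2R (entry b t)) * W w t))))).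
  { intros h'. apply IH; auto. intros; apply HW; auto. now right. }
  clear IH. set (p := entry q t) in *.
  pose (Hc := fun h c w => h w + lsum l (fun t => (entry q t - b2R (entry c t)) * W w t ^ 2)).
  pose (X := fun (h : A -> R) => Eprod l q (fun b => Eprod l half (fun e => lmax a0 ls (fun w => h w
      + lsum l (fun t => 4 * (sgn (entry e t) * b2R (entry b t)) * W w t))))).
  apply Rle_trans with ((1 - p) * X h
     + p * (/ 2 * X (fun w => h w + 4 * W w t) + (1 - / 2) * X (fun w => h w - 4 * W w t))).
  - apply Rle_trans with ((1 - p) * Eprod l q (fun c => lmax a0 ls (Hc h c))
     + p * (/ 2 * Eprod l q (fun c => lmax a0 ls (Hc (fun w => h w + 4 * W w t) c))
            + (1 - / 2) * Eprod l q (fun c => lmax a0 ls (Hc (fun w => h w - 4 * W w t) c)))).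
    + rewrite Eprod_cons. fold p. rewrite <- !Eprod_lin. apply Eprod_le; auto. intros c.
      eapply Rle_trans; [|eapply Rle_trans;
        [apply (sym_contract_step a0 ls (Hc h c) (fun w => W w t) p Ht); intros; apply HW; auto; now left|]].
      * right. f_equal; f_equal; apply lmax_ext; intros w; rewrite lsum_cons;
          rewrite (lsum_cset l t c _ (fun t' x => (entry q t' - b2R x) * W w t' ^ 2)) by auto;
          rewrite entry_cset_same; fold p; unfold Hc, b2R; ring.
      * right. f_equal. f_equal. f_equal; f_equal; apply lmax_ext; intros w; unfold Hc; ring.
    + pose proof (IH' h). pose proof (IH' (fun w => h w + 4 * W w t)).
      pose proof (IH' (fun w => h w - 4 * W w t)).
      apply Rplus_le_compat; [apply Rmult_le_compat_l; [lra|assumption]|].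
      apply Rmult_le_compat_l; [lra|].
      apply Rplus_le_compat; apply Rmult_le_compat_l; try lra; assumption.
  - right. rewrite Eprod_cons. fold p. rewrite Rplus_comm. f_equal; f_equal.
    + unfold X. rewrite <- Eprod_lin. apply Eprod_ext. intros b.
      rewrite Eprod_cons. unfold half at 3 5. rewrite !entry_const.
      f_equal; f_equal; apply Eprod_ext; intros e; apply lmax_ext; intros w; rewrite lsum_cons.
      * rewrite (lsum_ext l (fun t' => 4 * (sgn (entry (cset e t true) t')
                   * b2R (entry (cset b t true) t')) * W w t')
                 (fun t' => 4 * (sgn (entry e t') * b2R (entry b t')) * W w t')).
        -- rewrite !entry_cset_same. unfold sgn at 2. unfold b2R at 2. ring.
        -- intros t' Ht'. rewrite !entry_cset_other; auto; intros ->; contradiction.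
      * rewrite (lsum_ext l (fun t' => 4 * (sgn (entry (cset e t false) t')
                   * b2R (entry (cset b t true) t')) * W w t')
                 (fun t' => 4 * (sgn (entry e t') * b2R (entry b t')) * W w t')).
        -- rewrite !entry_cset_same. unfold sgn at 2. unfold b2R at 2. ring.
        -- intros t' Ht'. rewrite !entry_cset_other; auto; intros ->; contradiction.
    + unfold X. apply Eprod_ext. intros b. rewrite Eprod_cons. unfold half at 2 4.
      rewrite !entry_const.
      (* When [t] is unsampled its sign has no effect, so the expectation over that sign averages
         two equal terms. *)
      match goal with |- ?L = _ => transitivity (/ 2 * L + (1 - / 2) * L); [field|] end.
      f_equal; f_equal; apply Eprod_ext; intros e; apply lmax_ext; intros w; rewrite lsum_cons.
      * rewrite (lsum_ext l (fun t' => 4 * (sgn (entry (cset e t true) t')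
                   * b2R (entry (cset b t false) t')) * W w t')
                 (fun t' => 4 * (sgn (entry e t') * b2R (entry b t')) * W w t')).
        -- rewrite !entry_cset_same. unfold b2R at 2. ring.
        -- intros t' Ht'. rewrite !entry_cset_other; auto; intros ->; contradiction.
      * rewrite (lsum_ext l (fun t' => 4 * (sgn (entry (cset e t false) t')
                   * b2R (entry (cset b t false) t')) * W w t')
                 (fun t' => 4 * (sgn (entry e t') * b2R (entry b t')) * W w t')).
        -- rewrite !entry_cset_same. unfold b2R at 2. ring.
        -- intros t' Ht'. rewrite !entry_cset_other; auto; intros ->; contradiction.
Qed.

(** Symmetrization bounds the mean by [T / 4], and a Chernoff bound with parameter [s] covers the
    remaining gap up to [T / 2]. *)
Lemma sampling_deviation l q (P : (nat * nat * nat -> R) -> Prop) (Rad : cfg -> cfg -> R) T V s :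
  NoDup l -> prob_on l q -> 0 <= s -> P (fun _ => 0) ->
  (forall W, P W -> (forall t, In t l -> Rabs (W t) <= 1)) ->
  (forall W, P W -> lsum l (fun t => W t ^ 2) <= V) ->
  (forall W b e, P W ->
     lsum l (fun t => 4 * (sgn (entry e t) * b2R (entry b t)) * W t) <= Rad b e) ->
  Eprod l q (fun b => Eprod l half (fun e => Rad b e)) <= T / 4 ->
  1 - exp (- (s * T / 4) + 2 * s ^ 2 * V) <= Eprod l q (fun b => indic (forall W, P W ->
     lsum l (fun t => (entry q t - b2R (entry b t)) * W t ^ 2) < T / 2)).
Proof.
  intros Hnd Hq Hs HP0 HP1 HPV HPR HRad.
  pose (dev := fun (W : nat * nat * nat -> R) b =>
     lsum l (fun t => (entry q t - b2R (entry b t)) * W t ^ 2)).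
  pose (bad := fun b W => P W /\ T / 2 <= dev W b).
  (* One violating [W] is selected per bad configuration, and zero for the good ones. The maximum
     over these finitely many witnesses reaches [T / 2] at every bad configuration. *)
  pose (wit := fun b => if excluded_middle_informative (exists W, bad b W)
                        then epsilon (inhabits (fun _ => 0)) (bad b) else (fun _ => 0)).
  assert (Hwit : forall b, P (wit b)).
  { intros b. unfold wit. destruct excluded_middle_informative as [E|E]; auto.
    apply (epsilon_spec (inhabits (fun _ => 0)) (bad b) E). }
  set (ls := map wit (configs l)). set (a0 := fun _ : nat * nat * nat => 0).
  assert (HPls : forall W, In W (a0 :: ls) -> P W).
  { intros W [<-|HW]; [exact HP0|]. apply in_map_iff in HW as (b & <- & _). apply Hwit. }
  set (F := fun b => lmax a0 ls (fun W => dev W b)).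
  assert (HEF : Eprod l q F <= T / 4).
  { eapply Rle_trans; [|exact HRad].
    eapply Rle_trans; [|eapply Rle_trans;
      [apply (symmetrization_contraction a0 ls (fun W t => W t) l q (fun _ => 0)); auto|]].
    - right. apply Eprod_ext. intros b. apply lmax_ext. intros W. unfold dev. ring.
    - apply Eprod_le; auto. intros b. apply Eprod_le.
      + intros t _. unfold half. rewrite entry_const. lra.
      + intros e. apply lmax_le. intros W HW. rewrite Rplus_0_l. apply HPR; auto. }
  assert (Hlip : Eprod l q (fun c => exp (s * F c)) <= exp (s * Eprod l q F + 2 * s ^ 2 * V)).
  { apply lipschitz_exp_moment; auto. intros x.
    destruct (lmax_attained a0 ls (fun W => dev W x)) as (W & HW & E).
    (* For the maximizer [W] at [x], flipping entry [t] lowers the deviation by at most [W t ^ 2];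
       as entries are at most [1], the sum of [W t ^ 4] is at most that of [W t ^ 2]. *)
    exists (fun t => W t ^ 2). split; [intros; apply pow2_ge_0|]. split.
    - eapply Rle_trans; [|apply (HPV W); auto]. apply lsum_le. intros t Ht.
      pose proof (HP1 W (HPls W HW) t Ht) as H1.
      assert (0 <= W t ^ 2 <= 1).
      { split; [apply pow2_ge_0|]. rewrite <- pow2_abs. pose proof (Rabs_pos (W t)). nra. }
      nra.
    - intros y. unfold F. rewrite E.
      apply Rle_trans with (dev W y); [|exact (lmax_ge a0 ls (fun W => dev W y) W HW)].
      unfold dev. rewrite <- lsum_minus. apply lsum_le. intros t _.
      pose proof (pow2_ge_0 (W t)) as H2. unfold differ, b2R.
      destruct (entry x t), (entry y t); cbn [Bool.eqb]; lra. }
  (* Markov's inequality in pointwise form: the good indicator dominates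
     [1 - exp (s * (F b - T / 2))]. *)
  apply Rle_trans with (1 - exp (- (s * T / 2)) * Eprod l q (fun c => exp (s * F c))).
  - assert (exp (- (s * T / 2)) * Eprod l q (fun c => exp (s * F c))
            <= exp (- (s * T / 4) + 2 * s ^ 2 * V)); [|lra].
    eapply Rle_trans; [apply Rmult_le_compat_l; [left; apply exp_pos|exact Hlip]|].
    rewrite <- exp_plus. apply exp_le.
    assert (s * Eprod l q F <= s * (T / 4)) by (apply Rmult_le_compat_l; lra). lra.
  - replace (1 - exp (- (s * T / 2)) * Eprod l q (fun c => exp (s * F c)))
      with (Eprod l q (fun c => 1 + (- exp (- (s * T / 2))) * exp (s * F c)))
      by (rewrite Eprod_affine; ring).
    apply Eprod_le_in; auto. intros b Hb. unfold indic.
    destruct excluded_middle_informative as [Hgood|Hbad].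
    + assert (0 < exp (- (s * T / 2)) * exp (s * F b)) by (apply Rmult_lt_0_compat; apply exp_pos).
      lra.
    + assert (Hex : exists W, bad b W).
      { apply NNPP. intros Hno. apply Hbad. intros W HW. apply Rnot_le_lt. intros Hle.
        apply Hno. exists W. split; assumption. }
      assert (HF : T / 2 <= F b).
      { apply Rle_trans with (dev (wit b) b).
        - unfold wit. destruct excluded_middle_informative as [E|E]; [|contradiction].
          apply (epsilon_spec (inhabits (fun _ => 0)) (bad b) E).
        - apply (lmax_ge a0 ls (fun W => dev W b)). right. now apply in_map. }
      assert (1 <= exp (- (s * T / 2)) * exp (s * F b)); [|lra].
      rewrite <- exp_plus, <- exp_0. apply exp_le.
      assert (s * (T / 2) <= s * F b) by (apply Rmult_le_compat_l; lra). lra.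
Qed.

(** * Specialization to collective matrices *)

Definition cols (V : nat) (d : nat -> nat) : list (nat * nat) :=
  flat_map (fun v => map (pair v) (seq 0 (d v))) (seq 0 V).

Definition mat (A : cmat) : nat -> nat * nat -> R := fun i c => A (fst c) i (snd c).

Lemma rsum_lsum n f : rsum n f = lsum (seq 0 n) f.
Proof.
  induction n as [|n IH]; [reflexivity|].
  rewrite seq_S, lsum_app. simpl. rewrite IH. ring.
Qed.

Lemma csum2_lsum V d f : csum2 V d f = lsum (cols V d) (fun c => f (fst c) (snd c)).
Proof.
  unfold csum2, cols. rewrite lsum_pairs, rsum_lsum. apply lsum_ext. intros v _.
  apply rsum_lsum.
Qed.

Lemma csum3_idx V du d f : csum3 V du d f = lsum (idx_list V du d) (entry f).
Proof.
  unfold csum3, idx_list. rewrite lsum_flat_map, rsum_lsum. apply lsum_ext. intros v _.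
  rewrite lsum_flat_map, rsum_lsum. apply lsum_ext. intros i _.
  rewrite lsum_map, rsum_lsum. reflexivity.
Qed.

Lemma idx_mat V du d f : lsum (idx_list V du d) (entry f)
  = lsum (seq 0 du) (fun i => lsum (cols V d) (fun c => mat f i c)).
Proof.
  unfold idx_list, cols. rewrite lsum_flat_map.
  rewrite (lsum_ext (seq 0 du) _ (fun i => lsum (seq 0 V) (fun v => lsum (seq 0 (d v)) (fun j => f v i j)))).
  - rewrite (lsum_swap (seq 0 du)). apply lsum_ext. intros v _.
    rewrite lsum_flat_map. apply lsum_ext. intros i _. now rewrite lsum_map.
  - intros i _. rewrite lsum_pairs. reflexivity.
Qed.

Lemma in_cols V d c : In c (cols V d) <-> (fst c < V)%nat /\ (snd c < d (fst c))%nat.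
Proof.
  unfold cols. rewrite in_flat_map. split.
  - intros (v & Hv & Hc). apply in_map_iff in Hc as (j & <- & Hj).
    apply in_seq in Hv, Hj. simpl. lia.
  - intros [Hv Hj]. exists (fst c). split; [apply in_seq; lia|].
    apply in_map_iff. exists (snd c). split; [now destruct c|apply in_seq; lia].
Qed.

Lemma in_idx V du d v i j : In (v, i, j) (idx_list V du d) <-> in_range V du d v i j.
Proof.
  unfold idx_list, in_range. rewrite in_flat_map. split.
  - intros (v' & Hv & H). apply in_flat_map in H as (i' & Hi & H).
    apply in_map_iff in H as (j' & E & Hj). injection E as -> -> ->.
    apply in_seq in Hv, Hi, Hj. lia.
  - intros (Hv & Hi & Hj). exists v. split; [apply in_seq; lia|].
    apply in_flat_map. exists i. split; [apply in_seq; lia|].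
    apply in_map_iff. exists j. split; [reflexivity|apply in_seq; lia].
Qed.

Lemma NoDup_flat_map_disjoint {A B} (g : A -> list B) (l : list A) :
  NoDup l -> (forall a, NoDup (g a)) ->
  (forall a a' x, In x (g a) -> In x (g a') -> a = a') -> NoDup (flat_map g l).
Proof.
  intros Hl Hg Hd. induction Hl as [|a l Ha Hl IH]; simpl; [constructor|].
  apply NoDup_app; auto. intros x Hx Hx'.
  apply in_flat_map in Hx' as (a' & Ha' & Hx'). now rewrite (Hd a a' x Hx Hx') in Ha.
Qed.

Lemma idx_NoDup V du d : NoDup (idx_list V du d).
Proof.
  apply NoDup_flat_map_disjoint; [apply seq_NoDup| |].
  - intros v. apply NoDup_flat_map_disjoint; [apply seq_NoDup| |].
    + intros i. apply NoDup_map_NoDup_ForallPairs; [|apply seq_NoDup].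
      intros j j' _ _ E. congruence.
    + intros i i' x H H'. apply in_map_iff in H as (j & <- & _).
      apply in_map_iff in H' as (j' & E & _). congruence.
  - intros v v' x H H'. apply in_flat_map in H as (i & _ & H).
    apply in_flat_map in H' as (i' & _ & H').
    apply in_map_iff in H as (j & <- & _). apply in_map_iff in H' as (j' & E & _). congruence.
Qed.

(** [opnorm] is meaningful once [opnorm_set] has a least upper bound. The Frobenius norm bounds the
    set, and a column makes it nonempty. *)
Lemma opnorm_spec V du d A : (exists c, In c (cols V d)) ->
  op_le (seq 0 du) (cols V d) (mat A) (opnorm V du d A).
Proof.
  intros [c0 Hc0]. set (ro := seq 0 du). set (co := cols V d).
  assert (Hval : forall x, rsum du (fun i => (csum2 V d (fun v j => A v i j * x v j)) ^ 2)
     = dot ro (mv co (mat A) (fun c => x (fst c) (snd c))) (mv co (mat A) (fun c => x (fst c) (snd c)))).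
  { intros x. rewrite rsum_lsum. apply lsum_ext. intros i _. rewrite csum2_lsum. simpl.
    rewrite Rmult_1_r. reflexivity. }
  assert (Hone : forall x, csum2 V d (fun v j => x v j ^ 2)
     = dot co (fun c => x (fst c) (snd c)) (fun c => x (fst c) (snd c))).
  { intros x. rewrite csum2_lsum. apply lsum_ext. intros. simpl. ring. }
  assert (Hlub : is_lub (opnorm_set V du d A) (opnorm V du d A)).
  { apply (epsilon_spec (inhabits 0) (is_lub (opnorm_set V du d A))). destruct (completeness (opnorm_set V du d A)) as [m Hm]; [| |now exists m].
    - exists (sqrt (ip ro co (mat A) (mat A))). intros t (x & Hx & ->). apply sqrt_le_1_alt.
      rewrite Hval. rewrite Hone in Hx.
      pose proof (mv_sq_le ro co (mat A) (fun c => x (fst c) (snd c))) as H.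
      fold co in Hx. rewrite Hx in H. lra.
    - assert (Hpos : 0 < dot co (fun _ => 1) (fun _ => 1)).
      { apply Rlt_le_trans with (1 * 1); [lra|].
        apply (lsum_ge_term co (fun _ => 1 * 1) c0); [intros; lra|exact Hc0]. }
      pose proof (normalize co (fun _ => 1) Hpos) as Hn. cbv zeta in Hn.
      eexists. exists (fun _ _ => / sqrt (dot co (fun _ => 1) (fun _ => 1)) * 1).
      split; [|reflexivity]. rewrite Hone. exact Hn. }
  destruct Hlub as [Hub _].
  assert (Hge : forall y, dot co y y = 1 ->
            sqrt (dot ro (mv co (mat A) y) (mv co (mat A) y)) <= opnorm V du d A).
  { intros y Hy. apply Hub. exists (fun v j => y (v, j)). rewrite Hone, Hval.
    assert (E : forall c : nat * nat, y (fst c, snd c) = y c) by (now intros [v j]).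
    split.
    - rewrite <- Hy. apply dot_ext; intros; apply E.
    - f_equal. apply dot_ext; intros; apply dot_ext; auto. }
  assert (H0 : 0 <= opnorm V du d A).
  { assert (Hpos : 0 < dot co (fun _ => 1) (fun _ => 1)).
    { apply Rlt_le_trans with (1 * 1); [lra|].
      apply (lsum_ge_term co (fun _ => 1 * 1) c0); [intros; lra|exact Hc0]. }
    eapply Rle_trans; [apply sqrt_pos|]. apply Hge. exact (normalize co (fun _ => 1) Hpos). }
  split; [exact H0|].
  apply dot_sq_le_gen. intros y Hy. specialize (Hge y Hy).
  rewrite <- (pow2_sqrt (dot ro (mv co (mat A) y) (mv co (mat A) y))) by apply dot_nonneg.
  apply pow_incr. split; [apply sqrt_pos|exact Hge].
Qed.

Lemma svd_of_is_svd V du d A k sigma u w : is_svd V du d A k sigma u w ->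
  svd (seq 0 du) (cols V d) (mat A) k sigma u (fun l c => w l (fst c) (snd c)).
Proof.
  intros (Hs & Hu & Hw & HA). split; [exact Hs|]. split; [|split].
  - intros a b Ha Hb. rewrite <- (Hu a b Ha Hb), rsum_lsum. reflexivity.
  - intros a b Ha Hb. rewrite <- (Hw a b Ha Hb), csum2_lsum. reflexivity.
  - intros i [v j] Hi Hc. apply in_seq in Hi. apply in_cols in Hc. simpl in Hc.
    rewrite <- rsum_lsum. apply HA. unfold in_range. simpl. lia.
Qed.

Lemma is_svd_exists V du d A : exists k sigma u w, is_svd V du d A k sigma u w.
Proof.
  destruct (svd_exists du (cols V d) (mat A)) as (k & sigma & u & w & Hs & Hu & Hw & HA).
  exists k, sigma, u, (fun l v j => w l (v, j)).
  split; [exact Hs|]. split; [|split].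
  - intros a b Ha Hb. rewrite <- (Hu a b Ha Hb), rsum_lsum. reflexivity.
  - intros a b Ha Hb. rewrite <- (Hw a b Ha Hb), csum2_lsum.
    apply lsum_ext. now intros [v j] _.
  - intros v i j (Hv & Hi & Hj). rewrite rsum_lsum.
    apply (HA i (v, j)); [apply in_seq; lia|apply in_cols; simpl; lia].
Qed.

Lemma nucnorm_spec V du d A : exists k sigma u w,
  is_svd V du d A k sigma u w /\ nucnorm V du d A = lsum (seq 0 k) sigma.
Proof.
  assert (H : exists s, exists k sigma u w, is_svd V du d A k sigma u w /\ s = rsum k sigma).
  { destruct (is_svd_exists V du d A) as (k & sigma & u & w & H).
    exists (rsum k sigma), k, sigma, u, w. auto. }
  destruct (epsilon_spec (inhabits 0) _ H) as (k & sigma & u & w & Hsvd & E).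
  exists k, sigma, u, w. split; [exact Hsvd|]. rewrite <- rsum_lsum. exact E.
Qed.

(** Every left singular vector is [A (w l) / sigma l], hence a combination of the [rk] column
    factors of a minimal decomposition; [orth_rank_le] concludes. *)
Lemma svd_size_le_rk V du d A k sigma u w : is_svd V du d A k sigma u w ->
  (k <= rk V du d A)%nat.
Proof.
  intros Hsvd.
  assert (Hmin : exists k, rank_decomp V du d A k /\
                   forall k', rank_decomp V du d A k' -> (k <= k')%nat).
  { assert (Hk : rank_decomp V du d A k).
    { destruct Hsvd as (_ & _ & _ & HA). exists (fun l i => sigma l * u l i), w. exact HA. }
    revert Hk. clear Hsvd. induction k as [k IH] using lt_wf_ind. intros Hk.
    destruct (classic (exists k', rank_decomp V du d A k' /\ (k' < k)%nat)) as [(k' & H & Hlt)|Hno].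
    - now apply (IH k').
    - exists k. split; auto. intros k' H. apply Nat.nlt_ge. intros Hlt. apply Hno. now exists k'. }
  destruct (epsilon_spec (inhabits 0%nat) _ Hmin) as [(a & b & Hab) _].
  fold (rk V du d A) in Hab.
  apply svd_of_is_svd in Hsvd as (Hs & Hu & Hw & HA).
  set (co := cols V d) in *. set (w' := fun l (c : nat * nat) => w l (fst c) (snd c)) in *.
  apply (orth_rank_le (seq 0 du) k (rk V du d A) u a
           (fun m l => / sigma l * dot co (w' l) (fun c => b m (fst c) (snd c))) Hu).
  intros l i Hl Hi. pose proof (Hs l Hl) as Hpos.
  apply Rmult_eq_reg_l with (sigma l); [|lra].
  transitivity (mv co (mat A) (w' l) i).
  - unfold mv. rewrite (dot_ext co (mat A i) (w' l) (comb k (fun a => sigma a * u a i) w') (w' l)).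
    + now rewrite dot_comm, dot_comb_orth.
    + intros c Hc. now apply HA.
    + reflexivity.
  - unfold mv. rewrite (dot_ext co (mat A i) (w' l)
      (comb (rk V du d A) (fun m => a m i) (fun m c => b m (fst c) (snd c))) (w' l)).
    + rewrite dot_comm, dot_comb_r, <- lsum_scal. apply lsum_ext. intros m _.
      field. lra.
    + intros [v j] Hc. apply in_cols in Hc. apply in_seq in Hi. unfold comb.
      rewrite <- rsum_lsum. apply (Hab v i j). unfold in_range. simpl in *. lia.
    + reflexivity.
Qed.

(** Subtracting [m / 2 * x ^ 2] leaves a function with nondecreasing derivative on [[lo, hi]]; the
    mean value theorem then gives its tangent inequality. *)
Lemma strong_convexity (g g' g'' : R -> R) (lo hi m a b : R) :
  (forall x, derivable_pt_lim g x (g' x)) -> (forall x, derivable_pt_lim g' x (g'' x)) ->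
  (forall x, lo <= x <= hi -> m <= g'' x) -> lo <= a <= hi -> lo <= b <= hi ->
  g a + g' a * (b - a) + m / 2 * (b - a) ^ 2 <= g b.
Proof.
  intros Hg Hg' Hm Ha Hb.
  assert (Hmono : forall x y, lo <= x -> x <= y -> y <= hi -> m * (y - x) <= g' y - g' x).
  { intros x y Hx Hxy Hy. destruct (Req_dec x y) as [->|Hne]; [lra|].
    destruct (MVT_cor2 g' g'' x y ltac:(lra) (fun c _ => Hg' c)) as (c & E & Hc).
    rewrite E. apply Rmult_le_compat_r; [lra|]. apply Hm. lra. }
  pose (F := (g - mult_real_fct (m / 2) Rsqr)%F).
  assert (HF : forall x, derivable_pt_lim F x (g' x - m / 2 * (2 * x))).
  { intros x. apply derivable_pt_lim_minus; [apply Hg|].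
    apply derivable_pt_lim_scal, derivable_pt_lim_Rsqr. }
  assert (HFe : forall x, F x = g x - m / 2 * (x * x)) by reflexivity.
  assert (Hcvx : (g' a - m / 2 * (2 * a)) * (b - a) <= F b - F a).
  { destruct (Rtotal_order a b) as [Hlt|[->|Hlt]]; [|lra|].
    - destruct (MVT_cor2 F _ a b Hlt (fun c _ => HF c)) as (c & E & Hc).
      rewrite E. pose proof (Hmono a c ltac:(lra) ltac:(lra) ltac:(lra)).
      apply Rmult_le_compat_r; lra.
    - destruct (MVT_cor2 F _ b a Hlt (fun c _ => HF c)) as (c & E & Hc).
      pose proof (Hmono c a ltac:(lra) ltac:(lra) ltac:(lra)).
      assert ((g' c - m / 2 * (2 * c)) * (a - b) <= (g' a - m / 2 * (2 * a)) * (a - b))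
        by (apply Rmult_le_compat_r; lra).
      lra. }
  rewrite !HFe in Hcvx. lra.
Qed.

(** * Error bounds for the estimator *)

Lemma Rabs_le_inv x a : Rabs x <= a -> - a <= x <= a.
Proof. unfold Rabs. destruct Rcase_abs; lra. Qed.

Lemma nuc_le_weaken {I J} (ro : list I) (co : list J) A N N' :
  nuc_le ro co A N -> N <= N' -> nuc_le ro co A N'.
Proof.
  intros H HN Z s HZ. eapply Rle_trans; [exact (H Z s HZ)|].
  apply Rmult_le_compat_l; [apply HZ|exact HN].
Qed.

Lemma nuc_le_scal {I J} (ro : list I) (co : list J) A N c : 0 <= c ->
  nuc_le ro co A N -> nuc_le ro co (fun i j => c * A i j) (c * N).
Proof.
  intros Hc H Z s HZ. rewrite ip_comm, ip_scal_l, ip_comm.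
  pose proof (H Z s HZ).
  replace (s * (c * N)) with (c * (s * N)) by ring. now apply Rmult_le_compat_l.
Qed.

Lemma nuc_le_zero {I J} (ro : list I) (co : list J) N : 0 <= N ->
  nuc_le ro co (fun _ _ => 0) N.
Proof.
  intros HN Z s [Hs _]. rewrite ip_comm.
  rewrite (ip_ext ro co (fun _ _ => 0) Z (fun i j => 0 * Z i j) Z) by (intros; ring).
  rewrite ip_scal_l, Rmult_0_l. now apply Rmult_le_pos.
Qed.

Lemma estimator_bounds V du d gamma K Lg Ug lambda G G' G'' M b x Mh :
  (exists c, In c (cols V d)) -> 0 < INR du * INR (Dtot V d) ->
  0 < gamma -> supnorm_le V du d M gamma ->
  (forall v y, (v < V)%nat -> derivable_pt_lim (G v) y (G' v y)) ->
  (forall v y, (v < V)%nat -> derivable_pt_lim (G' v) y (G'' v y)) ->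
  0 < K ->
  (forall v eta, (v < V)%nat -> - gamma - / K <= eta <= gamma + / K ->
      Lg ^ 2 <= G'' v eta <= Ug ^ 2) ->
  0 < lambda ->
  lambda >= 2 * opnorm V du d (grad_negloglik V du d G' b x M) ->
  is_estimator V du d G gamma lambda b x Mh ->
  let D := fun v i j => Mh v i j - M v i j in
  let g := sqrt (INR (rk V du d M) * lsum (idx_list V du d) (entry (fun v i j => D v i j ^ 2))) in
  / (INR du * INR (Dtot V d)) * (Lg ^ 2 / 2)
    * lsum (idx_list V du d) (entry (fun v i j => b2R (b v i j) * D v i j ^ 2)) <= 2 * lambda * g
  /\ nuc_le (seq 0 du) (cols V d) (mat D) (6 * g).
Proof.
  intros Hco Hn Hgam HM HG HG' HK HL Hlam Hgrad [HMh Hopt] D g.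
  set (N := / (INR du * INR (Dtot V d))).
  assert (HN : 0 < N) by now apply Rinv_0_lt_compat.
  set (l := idx_list V du d) in *. set (ro := seq 0 du). set (co := cols V d) in *.
  destruct (nucnorm_spec V du d M) as (k & sigma & u & w & Hsvd & EM).
  destruct (nucnorm_spec V du d Mh) as (k' & sigma' & u' & w' & Hsvd' & EMh).
  pose proof (svd_size_le_rk _ _ _ _ _ _ _ _ Hsvd) as Hk.
  apply svd_of_is_svd in Hsvd, Hsvd'. fold ro co in Hsvd, Hsvd'.
  set (gr := grad_negloglik V du d G' b x M) in *.
  set (Q := N * (Lg ^ 2 / 2) * lsum l (entry (fun v i j => b2R (b v i j) * D v i j ^ 2))).
  assert (HQ : 0 <= Q).
  { unfold Q. apply Rmult_le_pos.
    - apply Rmult_le_pos; [lra|]. pose proof (pow2_ge_0 Lg). lra.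
    - apply lsum_nonneg. intros [[v i] j] _. simpl entry.
      apply Rmult_le_pos; [unfold b2R; destruct (b v i j); lra|apply pow2_ge_0]. }
  assert (HZ : op_le ro co (mat gr) (lambda / 2)).
  { apply op_le_weaken with (opnorm V du d gr); [now apply opnorm_spec|lra]. }
  assert (Hbasic : Q + ip ro co (mat gr) (mat D)
            <= lambda * (lsum (seq 0 k) sigma - lsum (seq 0 k') sigma')).
  { specialize (Hopt M HM). rewrite EM, EMh in Hopt.
    assert (Hip : ip ro co (mat gr) (mat D) = lsum l (entry (fun v i j => gr v i j * D v i j)))
      by (symmetry; apply idx_mat).
    (* Optimality has been tested at [M], and what remains is entrywise. An unobserved entry
       contributes zero to each side; for an observed one this is strong convexity, the linear term
       being the gradient. *)
    assert (Hdiff : Q + ip ro co (mat gr) (mat D)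
        <= negloglik V du d G b x Mh - negloglik V du d G b x M); [|lra].
    rewrite Hip. unfold Q, negloglik. rewrite !csum3_idx. fold N l.
    rewrite <- !lsum_scal, <- lsum_plus, <- lsum_minus. apply lsum_le.
    intros [[v i] j] Ht. apply in_idx in Ht. simpl entry.
    pose proof (HM v i j Ht) as H1. pose proof (HMh v i j Ht) as H2.
    assert (Hv : (v < V)%nat) by apply Ht.
    assert (0 < / K) by now apply Rinv_0_lt_compat.
    pose proof (strong_convexity (G v) (G' v) (G'' v) (- gamma) gamma (Lg ^ 2) (M v i j) (Mh v i j)
      (fun y => HG v y Hv) (fun y => HG' v y Hv)) as Hsc.
    assert (Hsc' : G v (M v i j) + G' v (M v i j) * (Mh v i j - M v i j)
                   + Lg ^ 2 / 2 * (Mh v i j - M v i j) ^ 2 <= G v (Mh v i j)).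
    { apply Hsc.
      - intros y Hy. apply HL; auto. lra.
      - now apply Rabs_le_inv.
      - now apply Rabs_le_inv. }
    unfold gr, grad_negloglik. fold N. unfold b2R. destruct (b v i j).
    - apply Rmult_le_compat_l with (r := N) in Hsc'; [|lra]. unfold D. lra.
    - lra. }
  destruct (penalized_bounds ro co (mat M) k sigma u _ (mat Mh) k' sigma' u' _ (mat gr) lambda Q
              Hsvd Hsvd' Hlam HZ HQ) as [HA HB].
  { exact Hbasic. }
  assert (Hg : sqrt (INR k * ip ro co (fun i c => mat Mh i c - mat M i c)
                               (fun i c => mat Mh i c - mat M i c)) <= g).
  { apply sqrt_le_1_alt.
    assert (E : ip ro co (fun i c => mat Mh i c - mat M i c) (fun i c => mat Mh i c - mat M i c)
                = lsum l (entry (fun v i j => D v i j ^ 2))).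
    { unfold l. rewrite idx_mat. apply lsum_ext. intros i _. apply lsum_ext. intros c _.
      unfold mat, D. simpl. ring. }
    rewrite E. apply Rmult_le_compat_r; [|now apply le_INR].
    apply lsum_nonneg. intros [[v i] j] _. apply pow2_ge_0. }
  split.
  - eapply Rle_trans; [exact HA|]. apply Rmult_le_compat_l; lra.
  - apply nuc_le_weaken with (1 := HB). lra.
Qed.

Lemma opnorm_nonneg V du d A : (exists c, In c (cols V d)) -> 0 <= opnorm V du d A.
Proof. intros H. apply (opnorm_spec V du d A H). Qed.

Lemma E_opnorm_SigmaR_nonneg V du d pi : (exists c, In c (cols V d)) ->
  prob_on (idx_list V du d) pi -> 0 <= E_opnorm_SigmaR V du d pi.
Proof.
  intros Hco Hq. unfold E_opnorm_SigmaR.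
  rewrite <- (Eprod_const (idx_list V du d) pi 0).
  apply Eprod_le; auto. intros b.
  rewrite <- (Eprod_const (idx_list V du d) (fun _ _ _ => / 2) 0).
  apply Eprod_le; [|intros; now apply opnorm_nonneg].
  intros t _. rewrite entry_const. lra.
Qed.

(* The set to which the deviation bound is applied; scaling an arbitrary matrix down to
   weighted norm [T] makes a peeling argument unnecessary. *)
Definition small_class V du d (r B : R) (W : nat * nat * nat -> R) : Prop :=
  (forall t, In t (idx_list V du d) -> Rabs (W t) <= 1) /\
  lsum (idx_list V du d) (fun t => W t ^ 2) <= B /\
  nuc_le (seq 0 du) (cols V d) (fun i c => W (fst c, i, snd c)) (6 * sqrt (r * B)).

Lemma restricted_strong_convexity V du d pi p r T :
  (exists c, In c (cols V d)) -> 0 < INR du * INR (Dtot V d) ->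
  prob_on (idx_list V du d) pi -> 0 < p -> 0 <= r -> 0 < T ->
  9216 * (r * (INR du * INR (Dtot V d)) ^ 2 * E_opnorm_SigmaR V du d pi ^ 2) / p <= T ->
  1 - exp (- (p * T / 128)) <= Eprod (idx_list V du d) pi (fun b => indic (
    forall W, small_class V du d r (T / p) W ->
     lsum (idx_list V du d) (fun t => (entry pi t - b2R (entry b t)) * W t ^ 2) < T / 2)).
Proof.
  intros Hco Hn Hq Hp Hr HT HTe. set (l := idx_list V du d) in *.
  set (n := INR du * INR (Dtot V d)) in *. set (e := E_opnorm_SigmaR V du d pi) in *.
  set (K := 6 * sqrt (r * (T / p))).
  assert (HTp : 0 < T / p) by now apply Rdiv_lt_0_compat.
  assert (HK : 0 <= K) by (unfold K; pose proof (sqrt_pos (r * (T / p))); lra).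
  assert (He : 0 <= e) by now apply E_opnorm_SigmaR_nonneg.
  (* [p / 16] minimizes the exponent [- s T / 4 + 2 s^2 T / p]. In the Rademacher bound, [4] comes
     from contraction and [n] undoes the normalization of [SigmaR]. *)
  pose proof (sampling_deviation l pi (small_class V du d r (T / p))
    (fun b e => 4 * n * K * opnorm V du d (SigmaR V du d b e)) T (T / p) (p / 16)) as H.
  replace (- (p / 16 * T / 4) + 2 * (p / 16) ^ 2 * (T / p)) with (- (p * T / 128)) in H
    by (field; lra).
  apply H; clear H; auto.
  - apply idx_NoDup.
  - lra.
  - split; [|split].
    + intros. rewrite Rabs_R0. lra.
    + rewrite (lsum_ext _ _ (fun _ => 0)) by (intros; ring). rewrite lsum_zero. lra.
    + now apply nuc_le_zero.
  - intros W HW. apply HW.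
  - intros W HW. apply HW.
  - intros W b eps (_ & _ & HW). fold K in HW.
    pose proof (HW (mat (SigmaR V du d b eps)) _ (opnorm_spec V du d (SigmaR V du d b eps) Hco)) as H.
    replace (lsum l (fun t => 4 * (sgn (entry eps t) * b2R (entry b t)) * W t))
      with (4 * n * ip (seq 0 du) (cols V d) (mat (SigmaR V du d b eps)) (fun i c => W (fst c, i, snd c))).
    + replace (4 * n * K * opnorm V du d (SigmaR V du d b eps))
        with (4 * n * (opnorm V du d (SigmaR V du d b eps) * K)) by ring.
      apply Rmult_le_compat_l; lra.
    + replace (ip (seq 0 du) (cols V d) (mat (SigmaR V du d b eps)) (fun i c => W (fst c, i, snd c)))
        with (lsum l (entry (fun v i j => SigmaR V du d b eps v i j * W (v, i, j))))
        by (apply (idx_mat V du d (fun v i j => SigmaR V du d b eps v i j * W (v, i, j)))).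
      rewrite <- lsum_scal. apply lsum_ext. intros [[v i] j] _. simpl entry.
      unfold SigmaR. fold n. field. lra.
  - assert (E : Eprod l pi (fun b => Eprod l half
       (fun e0 => 4 * n * K * opnorm V du d (SigmaR V du d b e0))) = 4 * n * K * e).
    { unfold e, E_opnorm_SigmaR. rewrite <- Eprod_scal. apply Eprod_ext. intros b.
      rewrite Eprod_scal. reflexivity. }
    rewrite E. unfold K.
    (* This is the mean condition [4 * n * K * e <= T / 4]; squaring it produces the constant [9216]
       in the lower bound on [T]. *)
    assert (Hs : 96 * n * e * sqrt (r * (T / p)) <= T); [|lra].
    apply le_of_sq_le; [lra|].
    rewrite Rpow_mult_distr, pow2_sqrt by (apply Rmult_le_pos; lra).
    replace ((96 * n * e) ^ 2 * (r * (T / p))) with (T * (9216 * (r * n ^ 2 * e ^ 2) / p))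
      by (field; lra).
    replace (T ^ 2) with (T * T) by ring. apply Rmult_le_compat_l; lra.
Qed.

Lemma Dtot_pos V d : (1 <= V)%nat -> (forall v, (v < V)%nat -> (1 <= d v)%nat) ->
  (1 <= Dtot V d)%nat.
Proof.
  intros HV Hd. unfold Dtot. destruct V as [|V]; [lia|]. simpl.
  pose proof (Hd 0%nat ltac:(lia)). lia.
Qed.

(** Here [36864 = 4 * 9216], and bounding a sum by twice a maximum doubles it to the final
    [73728]. *)
Lemma dichotomy_small (n p gamma lam L r e lg tau T : R) :
  0 < n -> 0 < p -> 0 < L -> 0 <= r ->
  T = 9216 * (lg + r * n ^ 2 * e ^ 2) / p ->
  tau <= 4 * gamma ^ 2 * T ->
  / n * tau <= 73728 / p * Rmax (n * r * (lam ^ 2 / L ^ 4 + gamma ^ 2 * e ^ 2))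
                                (gamma ^ 2 * lg / n).
Proof.
  intros Hn Hp HL Hr -> Htau.
  set (X1 := n * r * (lam ^ 2 / L ^ 4 + gamma ^ 2 * e ^ 2)).
  set (X2 := gamma ^ 2 * lg / n).
  assert (H1 : n * r * (gamma ^ 2 * e ^ 2) <= X1).
  { unfold X1. apply Rmult_le_compat_l; [apply Rmult_le_pos; lra|].
    assert (0 <= lam ^ 2 / L ^ 4); [|lra].
    apply Rmult_le_pos; [apply pow2_ge_0|left; apply Rinv_0_lt_compat, pow_lt, HL]. }
  apply Rle_trans with (36864 / p * (n * r * (gamma ^ 2 * e ^ 2) + X2)).
  - apply Rmult_le_reg_l with n; [exact Hn|].
    rewrite <- Rmult_assoc, Rinv_r, Rmult_1_l by lra.
    eapply Rle_trans; [exact Htau|]. right. unfold X2. field. lra.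
  - replace (73728 / p * Rmax X1 X2) with (36864 / p * (2 * Rmax X1 X2)) by (field; lra).
    apply Rmult_le_compat_l.
    + left. apply Rdiv_lt_0_compat; lra.
    + pose proof (Rmax_l X1 X2). pose proof (Rmax_r X1 X2). lra.
Qed.

(** Squaring the hypothesis and cancelling one factor [tau] leaves the constant [64], well below the
    one of the other regime. *)
Lemma dichotomy_large (n p gamma lam L r e lg tau : R) :
  0 < n -> 0 < p -> 0 < L -> 0 <= r -> 0 < lam -> 0 < tau ->
  / n * (L ^ 2 / 2) * (tau / 2) <= 2 * lam * sqrt (r * (tau / p)) ->
  / n * tau <= 73728 / p * Rmax (n * r * (lam ^ 2 / L ^ 4 + gamma ^ 2 * e ^ 2))
                                (gamma ^ 2 * lg / n).
Proof.
  intros Hn Hp HL Hr Hlam Htau H.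
  set (X2 := gamma ^ 2 * lg / n).
  assert (HL4 : 0 < L ^ 4) by (apply pow_lt, HL).
  assert (Hin : 0 < / n) by now apply Rinv_0_lt_compat.
  assert (Hsq : (/ n * (L ^ 2 / 2) * (tau / 2)) ^ 2 <= (2 * lam * sqrt (r * (tau / p))) ^ 2).
  { apply pow_incr. split; [|exact H].
    pose proof (pow2_ge_0 L).
    apply Rmult_le_pos; [apply Rmult_le_pos|]; lra. }
  rewrite (Rpow_mult_distr (2 * lam)) in Hsq.
  rewrite pow2_sqrt in Hsq
    by (apply Rmult_le_pos; [lra|left; now apply Rdiv_lt_0_compat]).
  assert (Hmain : / n * tau <= 64 / p * (n * r * (lam ^ 2 / L ^ 4))).
  { apply Rmult_le_reg_l with (/ n * L ^ 4 * tau / 16).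
    - unfold Rdiv. repeat apply Rmult_lt_0_compat; lra.
    - replace (/ n * L ^ 4 * tau / 16 * (/ n * tau)) with ((/ n * (L ^ 2 / 2) * (tau / 2)) ^ 2)
        by (field; lra).
      replace (/ n * L ^ 4 * tau / 16 * (64 / p * (n * r * (lam ^ 2 / L ^ 4))))
        with ((2 * lam) ^ 2 * (r * (tau / p))) by (field; lra).
      exact Hsq. }
  assert (HX : n * r * (lam ^ 2 / L ^ 4) <= n * r * (lam ^ 2 / L ^ 4 + gamma ^ 2 * e ^ 2)).
  { apply Rmult_le_compat_l; [apply Rmult_le_pos; lra|].
    pose proof (pow2_ge_0 gamma). pose proof (pow2_ge_0 e). nra. }
  assert (H0 : 0 <= n * r * (lam ^ 2 / L ^ 4)).
  { apply Rmult_le_pos; [apply Rmult_le_pos; lra|].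
    apply Rmult_le_pos; [apply pow2_ge_0|left; now apply Rinv_0_lt_compat]. }
  pose proof (Rmax_l (n * r * (lam ^ 2 / L ^ 4 + gamma ^ 2 * e ^ 2)) X2) as HM.
  assert (Hip : 0 < / p) by now apply Rinv_0_lt_compat.
  eapply Rle_trans; [exact Hmain|].
  apply Rmult_le_compat; [unfold Rdiv; lra|exact H0|unfold Rdiv; lra|].
  eapply Rle_trans; [exact HX|exact HM].
Qed.

Theorem theorem1 :
  exists c : R, 0 < c /\
  forall (V du : nat) (d : nat -> nat) (pi : cmat) (p gamma K Lg Ug lambda : R)
         (G G' G'' : nat -> R -> R) (M : cmat),
    (1 <= V)%nat -> (1 <= du)%nat -> (forall v, (v < V)%nat -> (1 <= d v)%nat) ->
    (forall v i j, in_range V du d v i j -> 0 <= pi v i j <= 1) ->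
    (* Assumption 1 *)
    0 < p < 1 -> (forall v i j, in_range V du d v i j -> p <= pi v i j) ->
    (* true parameter *)
    0 < gamma -> supnorm_le V du d M gamma ->
    (* Assumption 2 *)
    (forall v x, (v < V)%nat -> derivable_pt_lim (G v) x (G' v x)) ->
    (forall v x, (v < V)%nat -> derivable_pt_lim (G' v) x (G'' v x)) ->
    0 < K -> 0 < Lg -> 0 < Ug ->
    (forall v eta, (v < V)%nat -> - gamma - / K <= eta <= gamma + / K ->
        Lg ^ 2 <= G'' v eta <= Ug ^ 2) ->
    0 < lambda ->
    Eprod (idx_list V du d) pi (fun b => indic (
      forall (x : cmat) (Mh : cmat),
        lambda >= 2 * opnorm V du d (grad_negloglik V du d G' b x M) ->
        is_estimator V du d G gamma lambda b x Mh ->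
        / (INR du * INR (Dtot V d)) * wfrob2 V du d pi (fun v i j => Mh v i j - M v i j)
        <= c / p * Rmax
             (INR du * INR (Dtot V d) * INR (rk V du d M) *
                (lambda ^ 2 / Lg ^ 4 + gamma ^ 2 * (E_opnorm_SigmaR V du d pi) ^ 2))
             (gamma ^ 2 * ln (INR du + INR (Dtot V d)) / (INR du * INR (Dtot V d)))))
    >= 1 - 4 / (INR du + INR (Dtot V d)).
Proof.
  exists 73728. split; [lra|].
  intros V du d pi p gamma K Lg Ug lambda G G' G'' M HV Hdu Hd Hpi Hp Hpip Hgam HM
    HG HG' HK HLg HUg HL Hlam.
  assert (Hco : exists c, In c (cols V d)).
  { exists (0%nat, 0%nat). apply in_cols. simpl. pose proof (Hd 0%nat ltac:(lia)). lia. }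
  pose proof (le_INR _ _ (Dtot_pos V d HV Hd)) as HD. pose proof (le_INR _ _ Hdu) as Hdu'.
  simpl in HD, Hdu'.
  set (n := INR du * INR (Dtot V d)) in *.
  set (dd := INR du + INR (Dtot V d)) in *.
  assert (Hn : 0 < n) by (apply Rmult_lt_0_compat; lra).
  assert (Hdd : 2 <= dd) by (unfold dd; lra).
  assert (Hln : 0 < ln dd) by (rewrite <- ln_1; apply ln_increasing; lra).
  set (l := idx_list V du d) in *.
  assert (Hq : prob_on l pi).
  { intros [[v i] j] Ht. apply in_idx in Ht. now apply Hpi. }
  set (r := INR (rk V du d M)). set (e := E_opnorm_SigmaR V du d pi).
  assert (Hr : 0 <= r) by apply pos_INR.
  assert (Hre : 0 <= r * n ^ 2 * e ^ 2)
    by (apply Rmult_le_pos; [apply Rmult_le_pos; [exact Hr|]|]; apply pow2_ge_0).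
  set (T := 9216 * (ln dd + r * n ^ 2 * e ^ 2) / p).
  assert (HpT : p * T = 9216 * (ln dd + r * n ^ 2 * e ^ 2)) by (unfold T; field; lra).
  assert (HT : 0 < T) by (unfold T; apply Rdiv_lt_0_compat; lra).
  apply Rle_ge.
  apply Rle_trans with (1 - exp (- (p * T / 128))).
  (* Since [9216 / 128 = 72], the exponent is at least [72 * ln dd], far more than the claimed
     probability requires. *)
  { assert (exp (- (p * T / 128)) <= / dd).
    { replace (/ dd) with (exp (- ln dd)) by (rewrite exp_Ropp, exp_ln; lra).
      apply exp_le. lra. }
    assert (0 < / dd) by (apply Rinv_0_lt_compat; lra). unfold Rdiv. lra. }
  eapply Rle_trans; [apply (restricted_strong_convexity V du d pi p r T Hco Hn Hq); try lra|].
  { fold n e. unfold T, Rdiv. apply Rmult_le_compat_r; [left; apply Rinv_0_lt_compat; lra|]. lra. }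
  apply Eprod_le; auto. intros b. unfold indic.
  destruct excluded_middle_informative as [Hgood|]; destruct excluded_middle_informative as [|Hbad];
    try lra.
  exfalso. apply Hbad. intros x Mh Hgrad Hest. fold n r e dd.
  destruct (estimator_bounds V du d gamma K Lg Ug lambda G G' G'' M b x Mh) as [Hquad Hnuc]; auto.
  set (D := fun v i j => Mh v i j - M v i j) in *. fold l n r in Hquad, Hnuc. fold l in Hgood.
  set (f2 := lsum l (entry (fun v i j => D v i j ^ 2))) in *.
  set (bD := lsum l (entry (fun v i j => b2R (b v i j) * D v i j ^ 2))) in *.
  unfold wfrob2. rewrite csum3_idx. fold l.
  set (tau := lsum l (entry (fun v i j => pi v i j * D v i j ^ 2))).
  (* Beyond this threshold, scaling [D] to weighted norm [T] brings its entries, at most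
     [2 * gamma], below [1], as [small_class] demands. *)
  destruct (Rle_dec tau (4 * gamma ^ 2 * T)) as [Hsmall|Hlarge].
  { now apply (dichotomy_small n p gamma lambda Lg r e (ln dd) tau T). }
  apply Rnot_le_lt in Hlarge.
  assert (Hg2 : 0 < gamma ^ 2) by now apply pow_lt.
  assert (Htau : 0 < tau) by nra.
  assert (Hf2 : f2 <= tau / p).
  { apply Rmult_le_reg_l with p; [lra|]. replace (p * (tau / p)) with tau by (field; lra).
    unfold f2. rewrite <- lsum_scal. apply lsum_le. intros [[v i] j] Ht. apply in_idx in Ht.
    apply Rmult_le_compat_r; [apply pow2_ge_0|now apply Hpip]. }
  assert (Hf0 : 0 <= f2).
  { apply lsum_nonneg. intros [[v i] j] _. apply pow2_ge_0. }
  apply (dichotomy_large n p gamma lambda Lg r e (ln dd) tau); try lra.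
  apply Rle_trans with (2 * lambda * sqrt (r * f2)).
  2:{ apply Rmult_le_compat_l; [lra|]. apply sqrt_le_1_alt. now apply Rmult_le_compat_l. }
  eapply Rle_trans; [|exact Hquad].
  apply Rmult_le_compat_l.
  { apply Rmult_le_pos; [left; now apply Rinv_0_lt_compat|]. pose proof (pow2_ge_0 Lg). lra. }
  set (beta := sqrt (T / tau)).
  assert (Hb0 : 0 < beta) by (apply sqrt_lt_R0; now apply Rdiv_lt_0_compat).
  assert (Hb2 : beta ^ 2 = T / tau) by (apply pow2_sqrt; left; now apply Rdiv_lt_0_compat).
  assert (Hb2tau : beta ^ 2 * tau = T) by (rewrite Hb2; field; lra).
  assert (Hbg : beta * (2 * gamma) <= 1).
  { apply le_of_sq_le; [lra|]. apply Rmult_le_reg_r with tau; [exact Htau|].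
    replace ((beta * (2 * gamma)) ^ 2 * tau) with (4 * gamma ^ 2 * (beta ^ 2 * tau)) by ring.
    rewrite Hb2tau. lra. }
  assert (HW : lsum l (fun t => (entry pi t - b2R (entry b t)) * (beta * entry D t) ^ 2) < T / 2).
  { apply Hgood. split; [|split].
    - intros [[v i] j] Ht. apply in_idx in Ht. simpl entry.
      rewrite Rabs_mult, (Rabs_right beta) by lra.
      apply Rle_trans with (beta * (2 * gamma)); [|exact Hbg].
      apply Rmult_le_compat_l; [lra|].
      pose proof (Rabs_le_inv _ _ (HM v i j Ht)).
      pose proof (Rabs_le_inv _ _ (proj1 Hest v i j Ht)).
      unfold D. apply Rabs_le. lra.
    - fold l. rewrite (lsum_ext l _ (fun t => beta ^ 2 * entry (fun v i j => D v i j ^ 2) t))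
        by (intros [[v i] j] _; simpl entry; ring).
      rewrite lsum_scal. fold f2.
      replace (T / p) with (beta ^ 2 * (tau / p)) by (rewrite <- Hb2tau; field; lra).
      apply Rmult_le_compat_l; [apply pow2_ge_0|exact Hf2].
    - apply nuc_le_weaken with (beta * (6 * sqrt (r * f2))).
      + apply (nuc_le_scal _ _ (mat D)); [lra|exact Hnuc].
      + replace (beta * (6 * sqrt (r * f2))) with (6 * (beta * sqrt (r * f2))) by ring.
        apply Rmult_le_compat_l; [lra|].
        apply le_of_sq_le; [apply sqrt_pos|].
        rewrite Rpow_mult_distr, !pow2_sqrt.
        * replace (T / p) with (beta ^ 2 * (tau / p)) by (rewrite <- Hb2tau; field; lra).
          replace (r * (beta ^ 2 * (tau / p))) with (beta ^ 2 * (r * (tau / p))) by ring.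
          apply Rmult_le_compat_l; [apply pow2_ge_0|]. now apply Rmult_le_compat_l.
        * apply Rmult_le_pos; [exact Hr|]. left. apply Rdiv_lt_0_compat; lra.
        * now apply Rmult_le_pos. }
  rewrite (lsum_ext l _ (fun t => beta ^ 2 * (entry (fun v i j => pi v i j * D v i j ^ 2) t
             - entry (fun v i j => b2R (b v i j) * D v i j ^ 2) t))) in HW
    by (intros [[v i] j] _; simpl entry; ring).
  rewrite lsum_scal, lsum_minus in HW. fold tau bD in HW.
  rewrite <- Hb2tau in HW.
  assert (Hb2p : 0 < beta ^ 2) by now apply pow_lt.
  (* Dividing [HW] by [beta ^ 2] undoes the scaling: the sampled part [bD] keeps more than half of
     [tau]. *)
  apply Rnot_lt_le. intros Hc. change (bD < tau / 2) in Hc.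
  assert (beta ^ 2 * (tau / 2) < beta ^ 2 * (tau - bD)) by (apply Rmult_lt_compat_l; lra).
  lra.
Qed.
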